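(* Let $p>2$ be a prime and let $K$ be a local field, finite over $\mathbb{Q}_p$, with prime $\mathfrak{q}_K\mid p$ and absolute ramification index $1$. Let $E_{/K}$ be an elliptic curve with a non-trivial $K$-rational $p$-torsion point. Put $L=K(\zeta_p)$ with $\zeta_p$ a primitive $p$-th root of unity and $F=K(E[p])$, and assume that $[F:L]\ge 2$, so that $F=L[\sqrt[p]{x}]$ for some $x\in\mathfrak{o}_L$. Let $\mathfrak{q}$ be the prime of $L$ over $\mathfrak{q}_K$ and $k=k(\mathfrak{q})$ its residue class field. Then: (i) $E$ cannot have good supersingular reduction at $\mathfrak{q}_K$. (ii) $E$ cannot have non-split multiplicative reduction at $\mathfrak{q}_K$. (iii) If $E$ has good ordinary, split multiplicative, or additive reduction at $\mathfrak{q}_K$, then $$\mathcal{X}_{\mathcal{J}_x}\otimes k=\begin{cases}\mathcal{X}_{\mathbf{A}^1_k}, & \text{if } \mathfrak{q}\nmid x,\\ \mathbb{A}^3_k, & \text{if } \mathfrak{q}\mid x,\end{cases}$$ where $\mathbf{A}^1_k$ denotes the first Weyl algebra over the affine $k$-line.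
   Context: $K(E[p])$ is the field generated over $K$ by the coordinates of all $p$-torsion points of $E$. For $x\in\mathfrak{o}_L$ and an integer $1\le r\le p-1$, the Jackson algebra $\mathcal{J}_x=\mathcal{J}_x(r)$ is the $\mathfrak{o}_L$-algebra on free non-commuting generators $e_0,e_1,e_2$ subject to the relations $$e_0e_1-\zeta^r e_1e_0=0,\quad e_2e_0-\zeta^r e_0e_2=0,\quad e_2e_1-\zeta^{2r}e_1e_2-xe_0-x(1-\zeta^{2r})=0,$$ where $\zeta=\zeta_p$. The first Weyl algebra over the affine line is $$\mathbf{A}^1_k=\frac{k[u]\langle t,\partial\rangle}{(\partial t-t\partial-u)}.$$ For an algebra $A$ over a field, the non-commutative space $\mathcal{X}_A$ is the pair $(\mathrm{Mod}(A),\boldsymbol{\mathcal{O}})$, where $\mathrm{Mod}(A)$ is the groupoid of left $A$-modules up to isomorphism and $\boldsymbol{\mathcal{O}}$ is the projective limit, over finite families $\{M_1,\dots,M_s\}$ of finite-dimensional $A$-modules, of the rings $(\mathrm{Hom}(M_i,M_j)\otimes \hat H_{ij})$, with $(\hat H_{ij})$ the matric pro-representing hull of the non-commutative deformation functor of the family. $\mathcal{X}_{\mathcal{J}_x}\otimes k$ means $\mathcal{X}_{\mathcal{J}_x\otimes_{\mathfrak{o}_L} k}$; the equalities in (iii) say that $\mathcal{J}_x\otimes_{\mathfrak{o}_L}k$ is isomorphic to $\mathbf{A}^1_k$, respectively to the commutative polynomial algebra in three variables over $k$ (whose space is denoted $\mathbb{A}^3_k$). *)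

(* Defs.v *)
From HB Require Import structures.
From mathcomp Require Import all_boot all_order all_algebra all_field.
From mathcomp Require Import boolp finmap monalg mpoly.

Set Implicit Arguments.
Unset Strict Implicit.
Unset Printing Implicit Defensive.

Import Order.TTheory GRing.Theory Num.Theory.
Local Open Scope ring_scope.

(* Normalized discrete valuations; the value at 0 is irrelevant, v 0 = +oo
   being encoded by testing x == 0 separately. *)
Record dvaluation (K : fieldType) := DValuation {
  dval :> K -> int;
  dvalM : forall x y, x != 0 -> y != 0 -> dval (x * y) = dval x + dval y;
  dvalD : forall x y, x != 0 -> y != 0 -> x + y != 0 ->
            Num.min (dval x) (dval y) <= dval (x + y);
  dval_surj : exists2 x, x != 0 & dval x = 1
}.

Definition vge (K : fieldType) (v : dvaluation K) (n : int) : {pred K} :=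
  [pred x | (x == 0) || (n <= v x)].

Definition vcomplete (K : fieldType) (v : dvaluation K) : Prop :=
  forall u : nat -> K,
    (forall n : int, exists N : nat,
       forall i j, (N <= i)%N -> (N <= j)%N -> u i - u j \in vge v n) ->
    exists l : K, forall n : int, exists N : nat,
      forall i, (N <= i)%N -> u i - l \in vge v n.

(* (K, v) is the completion of the rationals for the p-adic valuation. *)
Definition is_padic_numbers (p : nat) (K : fieldType) (v : dvaluation K)
    : Prop :=
  [/\ [pchar K] =i pred0,
      v p%:R = 1,
      vcomplete v
    & forall (a : K) (n : int), exists q : rat, a - ratr q \in vge v n].

(* v and w are both normalized, so e is the ramification index. *)
Definition lies_over (K : fieldType) (L : fieldExtType K)
    (v : dvaluation K) (w : dvaluation L) (e : nat) : Prop :=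
  (0 < e)%N /\ forall a : K, a != 0 -> w a%:A = e%:Z * v a.

Section ValuationRing.
Variables (K : fieldType) (v : dvaluation K).

Lemma dval1 : v 1 = 0.
Proof.
have /eqP := dvalM v (oner_neq0 K) (oner_neq0 K).
by rewrite mulr1 -subr_eq subrr => /eqP.
Qed.

Lemma dvalN1 : v (-1) = 0.
Proof.
have n0 : -1 != 0 :> K by rewrite oppr_eq0 oner_neq0.
have /eqP := dvalM v n0 n0.
by rewrite mulrNN mulr1 dval1 eq_sym -mulr2n -mulr_natr mulf_eq0 orbF => /eqP.
Qed.

Lemma vint_subring_closed : subring_closed (vge v 0).
Proof.
have vN y : y \in vge v 0 -> - y \in vge v 0.
  rewrite !inE oppr_eq0; case: (eqVneq y 0) => //= y0 vy.
  by rewrite -mulN1r dvalM ?oppr_eq0 ?oner_neq0 // dvalN1 add0r.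
split=> [|x y xv yv|x y].
- by rewrite inE dval1 lexx orbT.
- move/vN: yv xv; move: (- y) => {}y; rewrite !inE.
  case: (eqVneq x 0) => [->|x0]; first by rewrite add0r.
  case: (eqVneq y 0) => [->|y0]; first by rewrite addr0 (negPf x0).
  case: (eqVneq (x + y) 0) => //= xy0 vy vx.
  by apply: (le_trans _ (dvalD v x0 y0 xy0)); rewrite le_min vx vy.
- rewrite !inE mulf_eq0; case: (eqVneq x 0) => //= x0.
  case: (eqVneq y 0) => //= y0 vx vy.
  by rewrite dvalM // addr_ge0.
Qed.

HB.instance Definition _ :=
  GRing.isSubringClosed.Build K (vge v 0) vint_subring_closed.

Record ring_of_integers := RingOfIntegers {
  int_val : K;
  _ : int_val \in vge v 0
}.

HB.instance Definition _ := [isSub for int_val].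
HB.instance Definition _ := [Choice of ring_of_integers by <:].
HB.instance Definition _ :=
  [SubChoice_isSubComNzRing of ring_of_integers by <:].

Definition max_ideal : {pred ring_of_integers} :=
  [pred a | int_val a \in vge v 1].

Definition is_residue_field (k : fieldType)
    (res : {rmorphism ring_of_integers -> k}) : Prop :=
  (forall c : k, exists a, res a = c)
  /\ (forall a, res a = 0 <-> a \in max_ideal).

End ValuationRing.

Arguments max_ideal {K} v.

Definition is_algebraic_closure (F : fieldType) (Fbar : closedFieldType)
    (j : {rmorphism F -> Fbar}) : Prop :=
  forall z : Fbar, algebraicOver j z.

Definition generated_subfield (M : fieldType) (S : M -> Prop) (z : M) : Prop :=
  forall D : {pred M},
    divring_closed D -> (forall s, S s -> s \in D) -> z \in D.

(* y^2 + a1 x y + a3 y = x^3 + a2 x^2 + a4 x + a6 *)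
Record weierstrass (R : Type) := Weierstrass {
  wa1 : R; wa2 : R; wa3 : R; wa4 : R; wa6 : R
}.

Definition map_weierstrass (R S : Type) (f : R -> S) (W : weierstrass R) :=
  Weierstrass (f (wa1 W)) (f (wa2 W)) (f (wa3 W)) (f (wa4 W)) (f (wa6 W)).

Section Weierstrass.
Variables (R : comNzRingType) (W : weierstrass R).

Let a1 := wa1 W.
Let a2 := wa2 W.
Let a3 := wa3 W.
Let a4 := wa4 W.
Let a6 := wa6 W.

Definition disc : R :=
  let b2 := a1 ^+ 2 + 4%:R * a2 in
  let b4 := 2%:R * a4 + a1 * a3 in
  let b6 := a3 ^+ 2 + 4%:R * a6 in
  let b8 := a1 ^+ 2 * a6 + 4%:R * a2 * a6 - a1 * a3 * a4 + a2 * a3 ^+ 2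
            - a4 ^+ 2 in
  - b2 ^+ 2 * b8 - 8%:R * b4 ^+ 3 - 27%:R * b6 ^+ 2 + 9%:R * b2 * b4 * b6.

Definition weq (x y : R) : R :=
  y ^+ 2 + a1 * x * y + a3 * y - (x ^+ 3 + a2 * x ^+ 2 + a4 * x + a6).

(* The two last conditions are the vanishing of the partial derivatives. *)
Definition singular_point (x y : R) : Prop :=
  [/\ weq x y = 0,
      a1 * y - (3%:R * x ^+ 2 + 2%:R * a2 * x + a4) = 0
    & 2%:R * y + a1 * x + a3 = 0].

(* The Taylor expansion of weq at a singular point (x0, y0) is
   Y^2 + a1 X Y - (3 x0 + a2) X^2 - X^3 with X = x - x0 and Y = y - y0; s1 and
   s2 are the slopes of the two tangent lines when the quadratic part is
   (Y - s1 X) (Y - s2 X). *)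
Definition tangent_slopes (x0 y0 s1 s2 : R) : Prop :=
  singular_point x0 y0 /\
  'X^2 + a1 *: 'X - (3%:R * x0 + a2)%:P = ('X - s1%:P) * ('X - s2%:P).

End Weierstrass.

Inductive point (F : Type) := Infinity | Affine (x y : F).
Arguments Infinity {F}.

Section GroupLaw.
Variables (F : fieldType) (W : weierstrass F).

Let a1 := wa1 W.
Let a2 := wa2 W.
Let a3 := wa3 W.
Let a4 := wa4 W.
Let a6 := wa6 W.

Definition on_curve (P : point F) : Prop :=
  if P is Affine x y then weq W x y = 0 else True.

(* The line through both points (the tangent line if they are equal) is
   y = l x + m. *)
Definition addpt (P Q : point F) : point F :=
  match P, Q with
  | Infinity, _ => Q
  | _, Infinity => P
  | Affine x1 y1, Affine x2 y2 =>
    if (x1 == x2) && (y1 + y2 + a1 * x2 + a3 == 0) then Infinity else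
    let d := 2%:R * y1 + a1 * x1 + a3 in
    let l := if x1 == x2
             then (3%:R * x1 ^+ 2 + 2%:R * a2 * x1 + a4 - a1 * y1) / d
             else (y2 - y1) / (x2 - x1) in
    let m := if x1 == x2
             then (- x1 ^+ 3 + a4 * x1 + 2%:R * a6 - a3 * y1) / d
             else (y1 * x2 - y2 * x1) / (x2 - x1) in
    let x3 := l ^+ 2 + a1 * l - a2 - x1 - x2 in
    Affine x3 (- (l + a1) * x3 - m - a3)
  end.

Definition mulpt (n : nat) (P : point F) : point F := iter n (addpt P) Infinity.

Definition torsion_point (n : nat) (P : point F) : Prop :=
  on_curve P /\ mulpt n P = Infinity.

Definition torsion_coordinate (n : nat) (z : F) : Prop :=
  exists x y, torsion_point n (Affine x y) /\ (z = x \/ z = y).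

(* W' is obtained from W by x = u^2 x' + r, y = u^3 y' + u^2 s x' + t. *)
Definition isomorphic_curve (W' : weierstrass F) : Prop :=
  exists u r s t : F,
  u != 0 /\
  [/\ u * wa1 W' = a1 + 2%:R * s,
      u ^+ 2 * wa2 W' = a2 - s * a1 + 3%:R * r - s ^+ 2,
      u ^+ 3 * wa3 W' = a3 + r * a1 + 2%:R * t,
      u ^+ 4 * wa4 W' = a4 - s * a3 + 2%:R * r * a2 - (t + r * s) * a1
                        + 3%:R * r ^+ 2 - 2%:R * s * t
    & u ^+ 6 * wa6 W' = a6 + r * a4 + r ^+ 2 * a2 + r ^+ 3 - t * a3 - t ^+ 2
                        - r * t * a1].

End GroupLaw.

Section Reduction.
Variables (K : fieldType) (v : dvaluation K) (E : weierstrass K).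

Definition integral_model (W : weierstrass (ring_of_integers v)) : Prop :=
  isomorphic_curve E (map_weierstrass (@int_val _ v) W).

Definition minimal_model (W : weierstrass (ring_of_integers v)) : Prop :=
  integral_model W /\
  forall W', integral_model W' -> v (int_val (disc W)) <= v (int_val (disc W')).

Variables (k : fieldType) (res : {rmorphism ring_of_integers v -> k}).
Variables (kbar : closedFieldType) (jk : {rmorphism k -> kbar}).

Definition reduces_to (Et : weierstrass k) : Prop :=
  exists2 W, minimal_model W & Et = map_weierstrass res W.

Definition good_supersingular_reduction (p : nat) : Prop :=
  exists Et, [/\ reduces_to Et, disc Et != 0
    & forall P, torsion_point (map_weierstrass jk Et) p P -> P = Infinity].

Definition good_ordinary_reduction (p : nat) : Prop :=
  exists Et, [/\ reduces_to Et, disc Et != 0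
    & exists2 P, torsion_point (map_weierstrass jk Et) p P & P <> Infinity].

Definition multiplicative_reduction_with (Q : kbar -> kbar -> Prop) : Prop :=
  exists Et, reduces_to Et /\
  exists x0 y0 s1 s2 : kbar,
  [/\ tangent_slopes (map_weierstrass jk Et) x0 y0 s1 s2, s1 <> s2 & Q s1 s2].

Definition rational_slopes (s1 s2 : kbar) : Prop :=
  (exists c : k, s1 = jk c) /\ (exists c : k, s2 = jk c).

Definition split_multiplicative_reduction : Prop :=
  multiplicative_reduction_with rational_slopes.

Definition nonsplit_multiplicative_reduction : Prop :=
  multiplicative_reduction_with (fun s1 s2 => ~ rational_slopes s1 s2).

Definition additive_reduction : Prop :=
  exists Et, reduces_to Et /\
  exists x0 y0 s : kbar, tangent_slopes (map_weierstrass jk Et) x0 y0 s s.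

End Reduction.

Section TwoSidedIdeal.
Variables (A : nzRingType) (S : A -> Prop).

Definition two_sided_ideal (I : A -> Prop) : Prop :=
  [/\ I 0,
      forall x y, I x -> I y -> I (x + y),
      forall a x, I x -> I (a * x)
    & forall a x, I x -> I (x * a)].

Definition ideal_generated : {pred A} :=
  fun x => `[< forall I : A -> Prop,
               two_sided_ideal I -> (forall s, S s -> I s) -> I x >].

Lemma ideal_generated_ideal : two_sided_ideal ideal_generated.
Proof.
split=> [|x y /asboolP Ix /asboolP Iy|a x /asboolP Ix|a x /asboolP Ix];
  apply/asboolP => I iI sI; have [I0 ID Il Ir] := iI => //.
- by apply: ID; [apply: Ix | apply: Iy].
- by apply: Il; apply: Ix.
- by apply: Ir; apply: Ix.
Qed.

Lemma ideal_generated_zmod_closed : zmod_closed ideal_generated.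
Proof.
have [I0 ID Il _] := ideal_generated_ideal.
split=> [|x y Ix Iy]; first exact: I0.
by apply: ID => //; rewrite -mulN1r; apply: Il.
Qed.

HB.instance Definition _ :=
  GRing.isZmodClosed.Build A ideal_generated ideal_generated_zmod_closed.

Definition quotient_ring := Quotient.quot ideal_generated.

HB.instance Definition _ := GRing.Zmodule.on quotient_ring.

Definition quotient_pi (a : A) : quotient_ring :=
  (\pi_(Quotient.quot ideal_generated) a)%qT.

Definition quotient_repr (q : quotient_ring) : A :=
  @repr A (Quotient.quot ideal_generated) q.

Lemma quotient_reprK : cancel quotient_repr quotient_pi.
Proof. exact: reprK. Qed.

Lemma quotient_piE (a b : A) :
  (quotient_pi a = quotient_pi b) <-> (a - b \in ideal_generated).
Proof.
rewrite /quotient_pi Quotient.idealrBE.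
by split=> [/eqP //|/eqP].
Qed.

Lemma quotient_piB : zmod_morphism quotient_pi.
Proof. by move=> x y; rewrite /quotient_pi raddfB. Qed.

Definition quotient_one := quotient_pi 1.
Definition quotient_mul (x y : quotient_ring) : quotient_ring :=
  quotient_pi (quotient_repr x * quotient_repr y).

Lemma quotient_repr_pi (a : A) :
  quotient_repr (quotient_pi a) - a \in ideal_generated.
Proof. by apply/quotient_piE; rewrite quotient_reprK. Qed.

Lemma quotient_piM (a b : A) :
  quotient_mul (quotient_pi a) (quotient_pi b) = quotient_pi (a * b).
Proof.
have [_ ID Il Ir] := ideal_generated_ideal.
apply/quotient_piE.
set a' := quotient_repr _; set b' := quotient_repr _.
have -> : a' * b' - a * b = (a' - a) * b' + a * (b' - b).
  by rewrite mulrBl mulrBr addrA subrK.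
by apply: ID; [apply: Ir | apply: Il]; apply: quotient_repr_pi.
Qed.

Lemma quotient_piD (a b : A) :
  quotient_pi a + quotient_pi b = quotient_pi (a + b).
Proof. by rewrite /quotient_pi raddfD. Qed.

Lemma quotient_ind (P : quotient_ring -> Prop) :
  (forall a, P (quotient_pi a)) -> forall q, P q.
Proof. by move=> Ppi q; rewrite -[q]quotient_reprK. Qed.

Fact quotient_mulA : associative quotient_mul.
Proof.
elim/quotient_ind=> x; elim/quotient_ind=> y; elim/quotient_ind=> z.
by rewrite !quotient_piM mulrA.
Qed.

Fact quotient_mul1r : left_id quotient_one quotient_mul.
Proof. by elim/quotient_ind=> x; rewrite quotient_piM mul1r. Qed.

Fact quotient_mulr1 : right_id quotient_one quotient_mul.
Proof. by elim/quotient_ind=> x; rewrite quotient_piM mulr1. Qed.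

Fact quotient_mulDl : left_distributive quotient_mul +%R.
Proof.
elim/quotient_ind=> x; elim/quotient_ind=> y; elim/quotient_ind=> z.
by rewrite !(quotient_piD, quotient_piM) mulrDl.
Qed.

Fact quotient_mulDr : right_distributive quotient_mul +%R.
Proof.
elim/quotient_ind=> x; elim/quotient_ind=> y; elim/quotient_ind=> z.
by rewrite !(quotient_piD, quotient_piM) mulrDr.
Qed.

HB.instance Definition _ := GRing.Zmodule_isPzRing.Build quotient_ring
  quotient_mulA quotient_mul1r quotient_mulr1 quotient_mulDl quotient_mulDr.

Lemma quotient_pi_monoid_morphism : monoid_morphism quotient_pi.
Proof. by split=> // x y; rewrite -quotient_piM. Qed.

HB.instance Definition _ :=
  GRing.isZmodMorphism.Build A quotient_ring quotient_pi quotient_piB.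
HB.instance Definition _ := GRing.isMonoidMorphism.Build A quotient_ring
  quotient_pi quotient_pi_monoid_morphism.

End TwoSidedIdeal.

Arguments quotient_pi {A} S.

(* An R-algebra is given as a ring A, possibly zero, with its structure
   morphism R -> A: the algType of ssralg.v requires 1 != 0, which may fail in
   a quotient. *)
Definition isomorphic_algebras (R : comNzRingType) (A B : pzRingType)
    (iA : R -> A) (iB : R -> B) : Prop :=
  exists f : {rmorphism A -> B}, bijective f /\ forall c, f (iA c) = iB c.

Section Presentation.
Variables (R : comNzRingType) (X : choiceType).

Definition free_algebra := {malg R[{fmonom X}]}.

HB.instance Definition _ := GRing.Lalgebra.on free_algebra.

Definition free_gen (x : X) : free_algebra := mkmalgU (fmu x) 1.

Variable S : free_algebra -> Prop.

Definition presented_algebra := quotient_ring S.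

HB.instance Definition _ := GRing.PzRing.on presented_algebra.

Definition presented_scalar (c : R) : presented_algebra :=
  quotient_pi S c%:A.

End Presentation.

Section Jackson.
Variables (R : comNzRingType) (zeta x : R) (r : nat).

Let e0 : free_algebra R 'I_3 := free_gen R (Ordinal (isT : (0 < 3)%N)).
Let e1 : free_algebra R 'I_3 := free_gen R (Ordinal (isT : (1 < 3)%N)).
Let e2 : free_algebra R 'I_3 := free_gen R (Ordinal (isT : (2 < 3)%N)).

Inductive jackson_relation : free_algebra R 'I_3 -> Prop :=
| JacksonRel01 :
    jackson_relation (e0 * e1 - zeta ^+ r *: (e1 * e0))
| JacksonRel20 :
    jackson_relation (e2 * e0 - zeta ^+ r *: (e0 * e2))
| JacksonRel21 :
    jackson_relation (e2 * e1 - zeta ^+ (2 * r) *: (e1 * e2)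
                      - x *: e0 - (x * (1 - zeta ^+ (2 * r)))%:A).

Definition jackson_algebra := presented_algebra jackson_relation.

HB.instance Definition _ := GRing.PzRing.on jackson_algebra.

Definition jackson_scalar : R -> jackson_algebra :=
  presented_scalar jackson_relation.

End Jackson.

Section Weyl.
Variable k : fieldType.

(* The ground ring is k[u], with u = 'X. *)
Let t : free_algebra {poly k} 'I_2 := free_gen _ ord0.
Let d : free_algebra {poly k} 'I_2 := free_gen _ ord_max.

Inductive weyl_relation : free_algebra {poly k} 'I_2 -> Prop :=
| WeylRel : weyl_relation (d * t - t * d - 'X%:A).

Definition weyl_algebra_over_line := presented_algebra weyl_relation.

HB.instance Definition _ := GRing.PzRing.on weyl_algebra_over_line.

(* The structure morphism of the Weyl algebra as a k-algebra. *)
Definition weyl_scalar (c : k) : weyl_algebra_over_line :=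
  presented_scalar weyl_relation c%:P.

End Weyl.

(* The extension of scalars along f : R -> S of the R-algebra iA : R -> A: the
   S-algebra generated by symbols [a], which stand for the tensors of a with 1,
   subject to the relations making a |-> [a] a ring morphism that carries the
   action of R to that of S. *)
Section BaseChange.
Variables (R S : comNzRingType) (f : R -> S) (A : pzRingType) (iA : R -> A).

Let sym (a : A) : free_algebra S A := free_gen S a.

Inductive base_change_relation : free_algebra S A -> Prop :=
| BaseChangeD a b : base_change_relation (sym (a + b) - (sym a + sym b))
| BaseChangeM a b : base_change_relation (sym (a * b) - sym a * sym b)
| BaseChange1 : base_change_relation (sym 1 - 1)
| BaseChangeZ c a : base_change_relation (sym (iA c * a) - f c *: sym a).

Definition base_change := presented_algebra base_change_relation.

HB.instance Definition _ := GRing.PzRing.on base_change.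

Definition base_change_scalar : S -> base_change :=
  presented_scalar base_change_relation.

End BaseChange.

(* Main.v *)
Require Import Defs.
From HB Require Import structures.
From mathcomp Require Import all_boot all_order all_algebra all_field.
From mathcomp Require Import boolp ring.
From mathcomp Require monalg.
From mathcomp Require Import mpoly.

Set Implicit Arguments.
Unset Strict Implicit.
Unset Printing Implicit Defensive.

Import Order.TTheory GRing.Theory Num.Theory.
Local Open Scope ring_scope.

(** Why the theorem holds.

Reduction types.  The argument rests on v(p) = 1, with p odd.  As 2 is a unit,
the given p-torsion point can be transported to an integral model
y^2 = x^3 + a2 x^2 + a4 x + a6
([torsion_change], [complete_square_change]).  Its multiples are then followed
one addition of P at a time.

A p-torsion point P other than Infinity is integral ([integral_torsion]): a
nonintegral P can be rescaled so that it lies, modulo the square of the maximal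
ideal, on the cusp y^2 = x^3 at (1, 1).  There nP is (n^-2, n^-3) for n < p, and
the equality x((p-1)P) = x(P) forced by pP = Infinity makes p (p - 2) a multiple
of the square of the maximal ideal, against v(p) = 1.

Addition of a point with nonsingular reduction commutes with reduction
([reduces_add]).  Hence under good reduction P reduces to a nontrivial p-torsion
point, and the reduction is not supersingular.  Under nonsplit multiplicative
reduction, first let P reduce to a nonsingular point.  The nonsingular points
of a nodal cubic form a multiplicative group, and u^p = 1 implies u = 1 in
characteristic p ([nodal_no_torsion]).  If P reduces to the node, moved to
(0, 0), then a2 is not a square in the residue field, and
x(Q + R) = l^2 - a2 - x(Q) - x(R) cannot reduce to 0 when Q and R both reduce to
the node.  So the odd multiples of P reduce to the node and the even ones do
not ([meets_node_mulpt]); as p is odd, pP is not Infinity.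

Jackson algebras.  From zeta^p = 1 in residue characteristic p one gets that
zeta reduces to 1.  The Jackson relations thus reduce to: e0 commutes with e1
and e2, and e2 e1 - e1 e2 = c e0, with c the class of x.  If c is nonzero this
is the Weyl algebra with u = c e0, t = e1 and d = e2; if c = 0 it is the
commutative polynomial algebra.  Both isomorphisms follow by comparing
universal properties ([base_change_jackson_iso]). *)

(** * Universal properties of presented algebras *)

Section QuotientLift.
Variables (A : nzRingType) (S : A -> Prop) (T : pzRingType).
Variable F : {rmorphism A -> T}.
Hypothesis F_rel : forall s, S s -> F s = 0.

Lemma rmorph_ideal0 a : a \in ideal_generated S -> F a = 0.
Proof.
move=> /asboolP/(_ (fun b => F b = 0)); apply=> //; split=> [|x y|b x|b x].
- exact: rmorph0.
- by rewrite rmorphD => -> ->; rewrite addr0.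
- by rewrite rmorphM => ->; rewrite mulr0.
- by rewrite rmorphM => ->; rewrite mul0r.
Qed.

Definition quotient_lift (q : quotient_ring S) : T := F (quotient_repr q).

Lemma quotient_lift_pi a : quotient_lift (quotient_pi S a) = F a.
Proof.
apply/eqP; rewrite -subr_eq0 -rmorphB; apply/eqP/rmorph_ideal0.
exact: quotient_repr_pi.
Qed.

Lemma quotient_lift_is_zmod_morphism : zmod_morphism quotient_lift.
Proof.
elim/quotient_ind=> x; elim/quotient_ind=> y.
by rewrite -rmorphB !quotient_lift_pi rmorphB.
Qed.

Lemma quotient_lift_is_monoid_morphism : monoid_morphism quotient_lift.
Proof.
split; first by rewrite -(rmorph1 (quotient_pi S)) quotient_lift_pi rmorph1.
elim/quotient_ind=> x; elim/quotient_ind=> y.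
by rewrite -rmorphM !quotient_lift_pi rmorphM.
Qed.

HB.instance Definition _ :=
  GRing.isZmodMorphism.Build _ _ quotient_lift quotient_lift_is_zmod_morphism.
HB.instance Definition _ := GRing.isMonoidMorphism.Build _ _ quotient_lift
  quotient_lift_is_monoid_morphism.

Lemma quotient_lift_ex :
  exists G : {rmorphism quotient_ring S -> T},
    forall a, G (quotient_pi S a) = F a.
Proof. by exists quotient_lift; apply: quotient_lift_pi. Qed.

End QuotientLift.

Lemma zero_ring_eq (T : pzRingType) : 1 = 0 :> T -> forall y z : T, y = z.
Proof. by move=> T0 y z; rewrite -[y]mulr1 -[z]mulr1 T0 !mulr0. Qed.

(** A presented algebra may be the zero ring.  The lifts below treat such a
target apart and otherwise evaluate in a ring with 1 != 0. *)
Lemma zero_ring_rmorphism (A T : pzRingType) :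
  1 = 0 :> T -> inhabited {rmorphism A -> T}.
Proof.
move=> /zero_ring_eq all0; pose f (_ : A) : T := 0.
have fB : zmod_morphism f by move=> x y; apply: all0.
have fM : monoid_morphism f by split=> [|x y]; apply: all0.
pose mB := GRing.isZmodMorphism.Build _ _ f fB.
pose mM := GRing.isMonoidMorphism.Build _ _ f fM.
by split; exact: (HB.pack f mB mM : {rmorphism A -> T}).
Qed.

Section FreeLift.
Import monalg.
Variables (R : comNzRingType) (X : choiceType) (T : nzRingType).
Variables (i : {rmorphism R -> T}) (g : X -> T).
Hypothesis comm_ig : forall c x, GRing.comm (i c) (g x).

Lemma free_lift_nz_ex :
  exists F : {rmorphism free_algebra R X -> T},
    (forall c, F c%:A = i c) /\ forall x, F (free_gen R x) = g x.
Proof.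
pose h (m : {fmonom X}) : T := \prod_(x <- (m : seq X)) g x.
have hM : mmorphism h.
  by split=> [m1 m2|]; rewrite /h ?fmM ?big_cat // fm1 big_nil.
pose h' : {mmorphism {fmonom X} -> T} :=
  HB.pack h (isMultiplicative.Build _ _ h hM).
pose F : free_algebra R X -> T := monalg.mmap i h'.
have FB : zmod_morphism F by apply: monalg.mmap_is_additive.
have FM : monoid_morphism F.
  have [] : multiplicative F; last by split.
  apply: monalg.commr_mmap_is_multiplicative => p m m' /=.
  rewrite /h; elim: (m' : seq X) => [|x s IHs].
    by rewrite big_nil; apply: commr1.
  by rewrite big_cons; apply: commrM.
pose mB := GRing.isZmodMorphism.Build _ _ F FB.
pose mM := GRing.isMonoidMorphism.Build _ _ F FM.
pose F' : {rmorphism free_algebra R X -> T} := HB.pack F mB mM.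
exists F'; split=> [c|x].
  by rewrite /F' /= /F monalg.mmapZ monalg.mmap1 mulr1.
transitivity (i 1 * h (fmu x)); first exact: monalg.mmapU.
by rewrite rmorph1 mul1r /h fmU big_seq1.
Qed.

End FreeLift.

Lemma free_lift_ex (R : comNzRingType) (X : choiceType) (T : pzRingType)
    (i : {rmorphism R -> T}) (g : X -> T) :
    (forall c x, GRing.comm (i c) (g x)) ->
  exists F : {rmorphism free_algebra R X -> T},
    (forall c, F c%:A = i c) /\ forall x, F (free_gen R x) = g x.
Proof.
move=> comm_ig; have [T0 | T1] := eqVneq (1 : T) 0.
  have [F] := zero_ring_rmorphism (free_algebra R X) T0.
  by exists F; split=> *; apply: zero_ring_eq.
pose nzT := GRing.PzSemiRing_isNonZero.Build T T1.
pose T' : nzRingType := HB.pack T nzT.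
pose i' : {rmorphism R -> T'} := i.
have [F FE] := @free_lift_nz_ex R X T' i' g comm_ig.
by exists F.
Qed.

Section PresentedScalar.
Variables (R : comNzRingType) (X : choiceType) (S : free_algebra R X -> Prop).

Lemma presented_scalar_is_zmod_morphism : zmod_morphism (presented_scalar S).
Proof.
by move=> c d; rewrite /presented_scalar scalerBl (rmorphB (quotient_pi S)).
Qed.

Lemma presented_scalar_is_monoid_morphism :
  monoid_morphism (presented_scalar S).
Proof.
split=> [|c d]; rewrite /presented_scalar; first by rewrite scale1r rmorph1.
rewrite -(rmorphM (quotient_pi S)); congr quotient_pi.
by rewrite -scalerAl mul1r scalerA.
Qed.

HB.instance Definition _ := GRing.isZmodMorphism.Build R (presented_algebra S)
  (presented_scalar S) presented_scalar_is_zmod_morphism.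
HB.instance Definition _ := GRing.isMonoidMorphism.Build R
  (presented_algebra S) (presented_scalar S)
  presented_scalar_is_monoid_morphism.

Definition presented_gen (x : X) : presented_algebra S :=
  quotient_pi S (free_gen R x).

Lemma quotient_pi_scale c p :
  quotient_pi S (c *: p) = presented_scalar S c * quotient_pi S p.
Proof. by rewrite -(rmorphM (quotient_pi S)) -scalerAl mul1r. Qed.

End PresentedScalar.

Section PresentedGenerators.
Import monalg.
Variables (R : comNzRingType) (X : choiceType) (S : free_algebra R X -> Prop).

Lemma presented_scalar_comm c x :
  GRing.comm (presented_scalar S c) (presented_gen S x).
Proof.
rewrite /GRing.comm /presented_gen -!(rmorphM (quotient_pi S)).
congr quotient_pi; rewrite -mul_malgC mulr1 malgM_def fgmulUU [RHS]malgM_def.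
by rewrite /free_gen /malgC fgmulUU mulr1 mul1r mulm1 mul1m.
Qed.

(** A free algebra is spanned by the words in its generators. *)
Lemma presented_ind (P : presented_algebra S -> Prop) :
    (forall c, P (presented_scalar S c)) -> (forall x, P (presented_gen S x)) ->
    (forall a b, P a -> P b -> P (a + b)) ->
    (forall a b, P a -> P b -> P (a * b)) ->
  forall a, P a.
Proof.
move=> PC PX PD PM; elim/quotient_ind=> a.
rewrite [a]monalgE (rmorph_sum (quotient_pi S)).
apply: (big_ind P) => [|//|m _].
  by rewrite -(rmorph0 (presented_scalar S)); apply: PC.
move: (monalg.mcoeff m a) => c.
have -> : mkmalgU m c = c *: mkmalgU m 1 :> free_algebra R X.
  by rewrite -mul_malgC malgM_def fgmulUU mulr1 mul1m.
rewrite /= quotient_pi_scale; apply: (PM) => //.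
case: m => s; elim: s => [|x s IHs].
  have -> : mkmalgU (FMonom [::]) 1 = 1 :> free_algebra R X.
    by rewrite -fmoneE.
  rewrite (rmorph1 (quotient_pi S)) -(rmorph1 (presented_scalar S)).
  exact: PC.
have -> : mkmalgU (FMonom (x :: s)) 1 =
    free_gen R x * mkmalgU (FMonom s) 1 :> free_algebra R X.
  rewrite malgM_def fgmulUU mulr1; congr (mkmalgU _ _).
  by apply/eqP; rewrite fmP fmM fmU.
by rewrite (rmorphM (quotient_pi S)); apply: (PM) => //; apply: PX.
Qed.

End PresentedGenerators.

(** The relations are tested on an arbitrary lift F to the free algebra, so that
users of the lemma need not know how F is built. *)
Lemma presented_lift_ex (R : comNzRingType) (X : choiceType)
    (S : free_algebra R X -> Prop) (T : pzRingType)
    (i : {rmorphism R -> T}) (g : X -> T) :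
    (forall c x, GRing.comm (i c) (g x)) ->
    (forall F : {rmorphism free_algebra R X -> T},
       (forall c p, F (c *: p) = i c * F p) ->
       (forall x, F (free_gen R x) = g x) -> forall s, S s -> F s = 0) ->
  exists G : {rmorphism presented_algebra S -> T},
    (forall c, G (presented_scalar S c) = i c) /\
    (forall x, G (presented_gen S x) = g x).
Proof.
move=> comm_ig rel; have [F [FC Fgen]] := free_lift_ex comm_ig.
have FZ c p : F (c *: p) = i c * F p.
  by rewrite -FC -rmorphM -scalerAl mul1r.
have [G GE] := quotient_lift_ex (rel F FZ Fgen).
by exists G; split=> [c|x]; rewrite GE.
Qed.

Lemma poly_lift_ex (k : nzRingType) (T : pzRingType) (i : {rmorphism k -> T})
    (y : T) :
    (forall c, GRing.comm (i c) y) ->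
  exists G : {rmorphism {poly k} -> T}, (forall c, G c%:P = i c) /\ G 'X = y.
Proof.
move=> comm_iy; have [T0 | T1] := eqVneq (1 : T) 0.
  have [F] := zero_ring_rmorphism {poly k} T0.
  by exists F; split=> *; apply: zero_ring_eq.
pose nzT := GRing.PzSemiRing_isNonZero.Build T T1.
pose T' : nzRingType := HB.pack T nzT.
pose i' : {rmorphism k -> T'} := i.
have com' : commr_rmorph i' y by move=> c; apply: commr_sym.
pose F : {rmorphism {poly k} -> T'} := horner_morph com'.
exists F; split=> [c|].
  exact: (horner_morphC com').
exact: (horner_morphX com').
Qed.

(** Commutation with the whole image of k[X] follows from commutation with the
image of the scalars and of the variable. *)
Lemma poly_lift_comm (k : nzRingType) (T : pzRingType)
    (G : {rmorphism {poly k} -> T}) (z : T) :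
    (forall c, GRing.comm (G c%:P) z) -> GRing.comm (G 'X) z ->
  forall p, GRing.comm (G p) z.
Proof.
move=> commC commX; elim/poly_ind=> [|p c IHp].
  by rewrite rmorph0; apply/commr_sym/commr0.
rewrite rmorphD rmorphM; apply/commr_sym/commrD; last exact/commr_sym/commC.
by apply/commrM; apply/commr_sym.
Qed.

Lemma mpoly_lift_ex (n : nat) (k : nzRingType) (T : pzRingType)
    (i : {rmorphism k -> T}) (y : 'I_n -> T) :
    (forall a b : T, GRing.comm a b) ->
  exists G : {rmorphism {mpoly k[n]} -> T},
    (forall c, G c%:MP = i c) /\ forall j, G 'X_j = y j.
Proof.
move=> commT; have [T0 | T1] := eqVneq (1 : T) 0.
  have [F] := zero_ring_rmorphism {mpoly k[n]} T0.
  by exists F; split=> *; apply: zero_ring_eq.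
pose nzT := GRing.PzSemiRing_isNonZero.Build T T1.
pose comT := GRing.PzSemiRing_hasCommutativeMul.Build T commT.
pose T' : comNzRingType := HB.pack T nzT comT.
pose i' : {rmorphism k -> T'} := i.
pose F : {rmorphism {mpoly k[n]} -> T'} := mmap i' (y : 'I_n -> T').
exists F; split=> [c|j]; first exact: (mmapC (y : _ -> T') i').
by rewrite /F /= mmapX mmap1U.
Qed.

(** * The reduction of the Jackson algebra *)

Section BaseChangeUniversal.
Variables (R S : comNzRingType) (f : R -> S) (A : pzRingType) (iA : R -> A).

Definition base_change_in (a : A) : base_change f iA :=
  presented_gen (base_change_relation f iA) a.

Lemma base_change_in_is_zmod_morphism : zmod_morphism base_change_in.
Proof.
have inD a b : base_change_in (a + b) = base_change_in a + base_change_in b.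
  rewrite /base_change_in /presented_gen -(rmorphD (quotient_pi _)).
  apply/quotient_piE/asboolP => I _; apply; exact: BaseChangeD.
by move=> a b; apply/eqP; rewrite eq_sym subr_eq -inD subrK.
Qed.

Lemma base_change_in_is_monoid_morphism : monoid_morphism base_change_in.
Proof.
split=> [|a b]; rewrite /base_change_in /presented_gen.
  rewrite -(rmorph1 (quotient_pi (base_change_relation f iA))).
  by apply/quotient_piE/asboolP => I _; apply; apply: BaseChange1.
rewrite -(rmorphM (quotient_pi _)).
by apply/quotient_piE/asboolP => I _; apply; apply: BaseChangeM.
Qed.

HB.instance Definition _ := GRing.isZmodMorphism.Build A (base_change f iA)
  base_change_in base_change_in_is_zmod_morphism.
HB.instance Definition _ := GRing.isMonoidMorphism.Build A (base_change f iA)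
  base_change_in base_change_in_is_monoid_morphism.

Lemma base_change_inZ c a :
  base_change_in (iA c * a) =
    base_change_scalar f iA (f c) * base_change_in a.
Proof.
rewrite /base_change_scalar -quotient_pi_scale.
by apply/quotient_piE/asboolP => I _; apply; apply: BaseChangeZ.
Qed.

Lemma base_change_in_scalar c :
  base_change_in (iA c) = base_change_scalar f iA (f c).
Proof. by rewrite -[iA c]mulr1 base_change_inZ rmorph1 mulr1. Qed.

(** A morphism out of an extension of scalars amounts to a semilinear morphism
whose image commutes with the scalars. *)
Lemma base_change_lift_ex (T : pzRingType) (i : {rmorphism S -> T})
    (h : {rmorphism A -> T}) :
    (forall c a, GRing.comm (i c) (h a)) ->
    (forall c, h (iA c) = i (f c)) ->
  exists G : {rmorphism base_change f iA -> T},
    (forall c, G (base_change_scalar f iA c) = i c) /\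
    (forall a, G (base_change_in a) = h a).
Proof.
move=> comm_ih hiA; apply: presented_lift_ex => // F FZ Fgen s.
case=> {s} [a b|a b||c a]; rewrite (rmorphB F); apply/eqP;
  rewrite subr_eq0; apply/eqP.
- by rewrite (rmorphD F) !Fgen rmorphD.
- by rewrite (rmorphM F) !Fgen rmorphM.
- by rewrite (rmorph1 F) Fgen rmorph1.
- by rewrite Fgen rmorphM hiA; apply: etrans (esym (FZ _ _)); rewrite Fgen.
Qed.
End BaseChangeUniversal.

(** The two shapes of the Jackson relations, computed under a morphism out of a
free algebra. *)
Lemma free_lift_relation (R : comNzRingType) (X : choiceType) (T : pzRingType)
    (F : {rmorphism free_algebra R X -> T}) (i : {rmorphism R -> T})
    (g : X -> T) :
    (forall c p, F (c *: p) = i c * F p) ->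
    (forall x, F (free_gen R x) = g x) ->
  forall (c x d : R) (u v w : X),
    F (free_gen R u * free_gen R v - c *: (free_gen R v * free_gen R u)
       - x *: free_gen R w - d%:A) =
    g u * g v - i c * (g v * g u) - i x * g w - i d.
Proof.
move=> FZ Fgen c x d u v w.
have FM a b : F (free_gen R a * free_gen R b) = g a * g b.
  by rewrite -!Fgen; apply: rmorphM.
rewrite 3!(rmorphB F); congr (_ - _ - _ - _).
- exact: FM.
- by apply: etrans (FZ _ _) _; congr (_ * _); apply: FM.
- by apply: etrans (FZ _ _) _; congr (_ * _); apply: Fgen.
- by apply: etrans (FZ _ _) _; rewrite (rmorph1 F) mulr1.
Qed.

Lemma free_lift_commutation (R : comNzRingType) (X : choiceType)
    (T : pzRingType)
    (F : {rmorphism free_algebra R X -> T}) (i : {rmorphism R -> T})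
    (g : X -> T) :
    (forall c p, F (c *: p) = i c * F p) ->
    (forall x, F (free_gen R x) = g x) ->
  forall (c : R) (u v : X),
    F (free_gen R u * free_gen R v - c *: (free_gen R v * free_gen R u)) =
    g u * g v - i c * (g v * g u).
Proof.
move=> FZ Fgen c u v.
have FM a b : F (free_gen R a * free_gen R b) = g a * g b.
  by rewrite -!Fgen; apply: rmorphM.
rewrite (rmorphB F); congr (_ - _); first exact: FM.
by apply: etrans (FZ _ _) _; congr (_ * _); apply: FM.
Qed.

Section PresentedRelations.
Variables (R : comNzRingType) (X : choiceType) (S : free_algebra R X -> Prop).
Local Notation pi := (quotient_pi S).
Local Notation gen := (presented_gen S).
Local Notation iS := (presented_scalar S).

Lemma presented_commutation (c : R) (u v : X) :
    S (free_gen R u * free_gen R v - c *: (free_gen R v * free_gen R u)) ->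
  gen u * gen v = iS c * (gen v * gen u).
Proof.
move=> Srel.
have piM a b : gen a * gen b = pi (free_gen R a * free_gen R b).
  by rewrite (rmorphM pi).
rewrite !piM -quotient_pi_scale.
by apply/quotient_piE/asboolP => I _; apply.
Qed.

Lemma presented_relation (c x d : R) (u v w : X) :
    S (free_gen R u * free_gen R v - c *: (free_gen R v * free_gen R u)
       - x *: free_gen R w - d%:A) ->
  gen u * gen v = iS c * (gen v * gen u) + iS x * gen w + iS d.
Proof.
move=> Srel.
have piM a b : gen a * gen b = pi (free_gen R a * free_gen R b).
  by rewrite (rmorphM pi).
have piD a b : pi (a + b) = pi a + pi b by apply: (rmorphD pi).
rewrite !piM -!quotient_pi_scale -!piD.
by apply/quotient_piE/asboolP => I _; apply; rewrite !opprD !addrA.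
Qed.
End PresentedRelations.

Section JacksonUniversal.
Variables (R : comNzRingType) (zeta x : R) (r : nat).

Lemma ord3_eq (n : nat) (lt_n3 : (n < 3)%N) : Ordinal lt_n3 = inord n.
Proof. by apply: val_inj; rewrite /= inordK. Qed.

Let ord3E := (esym (ord3_eq (isT : (0 < 3)%N)),
  esym (ord3_eq (isT : (1 < 3)%N)), esym (ord3_eq (isT : (2 < 3)%N))).

Lemma ord3_ind (P : 'I_3 -> Prop) :
  P (inord 0) -> P (inord 1) -> P (inord 2) -> forall j, P j.
Proof.
move=> P0 P1 P2 [j lt_j3].
by rewrite ord3_eq; case: j lt_j3 => [|[|[|]]].
Qed.

Let iJ := jackson_scalar zeta x r.

Lemma jackson_lift_ex (T : pzRingType) (i : {rmorphism R -> T})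
    (y : 'I_3 -> T) :
    (forall c j, GRing.comm (i c) (y j)) ->
    y (inord 0) * y (inord 1) = i (zeta ^+ r) * (y (inord 1) * y (inord 0)) ->
    y (inord 2) * y (inord 0) = i (zeta ^+ r) * (y (inord 0) * y (inord 2)) ->
    y (inord 2) * y (inord 1) =
      i (zeta ^+ (2 * r)) * (y (inord 1) * y (inord 2)) + i x * y (inord 0)
      + i (x * (1 - zeta ^+ (2 * r))) ->
  exists G : {rmorphism jackson_algebra zeta x r -> T},
    (forall c, G (iJ c) = i c) /\
    (forall j, G (presented_gen (jackson_relation zeta x r) j) = y j).
Proof.
move=> comm_iy r01 r20 r21; apply: presented_lift_ex => // F FZ Fgen s.
case=> {s}.
- apply: etrans (free_lift_commutation FZ Fgen _ _ _) _.
  by rewrite 2!ord3_eq r01 subrr.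
- apply: etrans (free_lift_commutation FZ Fgen _ _ _) _.
  by rewrite 2!ord3_eq r20 subrr.
- apply: etrans (free_lift_relation FZ Fgen _ _ _ _ _ _) _.
  rewrite 3!ord3_eq r21; apply/eqP; rewrite !subr_eq add0r.
  by rewrite addrC [i _ * _ + _]addrC addrA.
Qed.

Let gen (n : nat) := presented_gen (jackson_relation zeta x r) (inord n).

Lemma jackson_rel01 : gen 0 * gen 1 = iJ (zeta ^+ r) * (gen 1 * gen 0).
Proof.
apply: presented_commutation.
by rewrite !ord3E; apply: JacksonRel01.
Qed.

Lemma jackson_rel20 : gen 2 * gen 0 = iJ (zeta ^+ r) * (gen 0 * gen 2).
Proof.
apply: presented_commutation.
by rewrite !ord3E; apply: JacksonRel20.
Qed.

Lemma jackson_rel21 :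
  gen 2 * gen 1 = iJ (zeta ^+ (2 * r)) * (gen 1 * gen 2) + iJ x * gen 0
    + iJ (x * (1 - zeta ^+ (2 * r))).
Proof.
apply: presented_relation.
by rewrite !ord3E; apply: JacksonRel21.
Qed.

End JacksonUniversal.

(** Scalars commute with generators, hence with everything they generate. *)
Lemma presented_scalar_central (R : comNzRingType) (X : choiceType)
    (S : free_algebra R X -> Prop) c (a : presented_algebra S) :
  GRing.comm (presented_scalar S c) a.
Proof.
elim/presented_ind: a => [d|y|a b|a b].
- by rewrite /GRing.comm -!rmorphM mulrC.
- exact: presented_scalar_comm.
- exact: commrD.
- exact: commrM.
Qed.

(** The Jackson relations for zeta = 1 and x = c. *)
Definition degenerate_jackson (k : nzRingType) (c : k) (T : pzRingType)
    (i : k -> T) (y : 'I_3 -> T) : Prop :=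
  [/\ forall d j, GRing.comm (i d) (y j),
      GRing.comm (y (inord 0)) (y (inord 1)),
      GRing.comm (y (inord 2)) (y (inord 0))
    & y (inord 2) * y (inord 1) =
      y (inord 1) * y (inord 2) + i c * y (inord 0)].

Definition algebra_generated (k : nzRingType) (I : Type) (T : pzRingType)
    (i : k -> T) (y : I -> T) : Prop :=
  forall P : T -> Prop,
    (forall c, P (i c)) -> (forall j, P (y j)) ->
    (forall a b, P a -> P b -> P (a + b)) ->
    (forall a b, P a -> P b -> P (a * b)) -> forall a, P a.

Lemma algebra_generated_ext (k : nzRingType) (I : Type) (T U : pzRingType)
    (i : k -> T) (y : I -> T) (F G : {rmorphism T -> U}) :
    algebra_generated i y ->
    (forall c, F (i c) = G (i c)) -> (forall j, F (y j) = G (y j)) ->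
  F =1 G.
Proof.
move=> gen eqi eqy; apply: gen => // a b eqa eqb.
  by rewrite !rmorphD eqa eqb.
by rewrite !rmorphM eqa eqb.
Qed.

(** Any algebra that is generated by, and universal for, the degenerate Jackson
relations is the base change, because the base change has both properties. The
generation hypothesis on B may be used to see that B is commutative. *)
Lemma base_change_jackson_iso (R k : comNzRingType) (f : {rmorphism R -> k})
    (zeta x : R) (r : nat) (T : pzRingType) (i : {rmorphism k -> T})
    (y : 'I_3 -> T) :
    f zeta = 1 -> degenerate_jackson (f x) i y -> algebra_generated i y ->
    (forall (B : pzRingType) (iB : {rmorphism k -> B}) (z : 'I_3 -> B),
       degenerate_jackson (f x) iB z -> algebra_generated iB z ->
     exists G : {rmorphism T -> B},
       (forall c, G (i c) = iB c) /\ (forall j, G (y j) = z j)) ->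
  isomorphic_algebras (base_change_scalar f (jackson_scalar zeta x r)) i.
Proof.
move=> fz yT genT lift.
have fzX n : f (zeta ^+ n) = 1 by rewrite rmorphXn fz expr1n.
have fx0 n : f (x * (1 - zeta ^+ n)) = 0.
  by rewrite rmorphM rmorphB rmorph1 fzX subrr mulr0.
pose iJ := jackson_scalar zeta x r.
pose B := base_change f iJ.
pose iB : {rmorphism k -> B} := presented_scalar (base_change_relation f iJ).
have [h [hC hX]] : exists h : {rmorphism jackson_algebra zeta x r -> T},
    (forall c, h (iJ c) = i (f c)) /\
    (forall j, h (presented_gen (jackson_relation zeta x r) j) = y j).
  have [yC y01 y20 y21] := yT.
  apply: (jackson_lift_ex (i := i \o f)) => [c j||| ] /=.
  - exact: yC.
  - by rewrite fzX rmorph1 mul1r.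
  - by rewrite fzX rmorph1 mul1r.
  - by rewrite fzX fx0 rmorph1 mul1r rmorph0 addr0.
have hcomm c a : GRing.comm (i c) (h a).
  have [yC _ _ _] := yT.
  elim/presented_ind: a => [d|j|a b ha hb|a b ha hb].
  - by rewrite [h _]hC /GRing.comm -!rmorphM mulrC.
  - by rewrite hX; apply: yC.
  - by rewrite rmorphD; apply: commrD.
  - by rewrite rmorphM; apply: commrM.
have [F [FC Fin]] := base_change_lift_ex hcomm hC.
pose z j : B := base_change_in f iJ (presented_gen _ j).
pose inB := base_change_in f iJ.
have inZ c a : inB (iJ c * a) = iB (f c) * inB a by apply: base_change_inZ.
have inC c : inB (iJ c) = iB (f c) by apply: base_change_in_scalar.
have inM a b : inB (a * b) = inB a * inB b by apply: rmorphM.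
have inD a b : inB (a + b) = inB a + inB b by apply: rmorphD.
(* The Jackson relations hold in the base change with zeta replaced by 1. *)
have zB : degenerate_jackson (f x) iB z.
  split=> [d j|||]; first exact: presented_scalar_central.
  - apply: etrans (esym (inM _ _)) _; rewrite [_ * _]jackson_rel01.
    by apply: etrans (inZ _ _) _; rewrite fzX (rmorph1 iB) mul1r inM.
  - apply: etrans (esym (inM _ _)) _; rewrite [_ * _]jackson_rel20.
    by apply: etrans (inZ _ _) _; rewrite fzX (rmorph1 iB) mul1r inM.
  - apply: etrans (esym (inM _ _)) _; rewrite [_ * _]jackson_rel21.
    apply: etrans (inD _ _) _; rewrite inC fx0 (rmorph0 iB) addr0.
    apply: etrans (inD _ _) _; congr (_ + _); last exact: inZ.
    by apply: etrans (inZ _ _) _; rewrite fzX (rmorph1 iB) mul1r inM.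
have genB : algebra_generated iB z.
  move=> P PC PX PD PM; elim/presented_ind => // a.
  suff: P (inB a) by [].
  elim/presented_ind: a => [c|j|a b Pa Pb|a b Pa Pb].
  - have -> : inB (presented_scalar _ c) = iB (f c) by apply: inC.
    exact: PC.
  - exact: PX.
  - by rewrite inD; apply: PD.
  - by rewrite inM; apply: PM.
have [G [GC GX]] := lift B iB z zB genB.
have Fz j : F (z j) = y j by rewrite [F _]Fin hX.
exists F; split=> //; exists G.
  apply: (algebra_generated_ext (F := G \o F) (G := idfun) genB) => [c|j] /=.
    by rewrite [F _]FC GC.
  by rewrite Fz GX.
apply: (algebra_generated_ext (F := F \o G) (G := idfun) genT) => [c|j] /=.
  by rewrite GC [F _]FC.
by rewrite GX Fz.
Qed.

(** The generators e0, e1, e2 correspond to u / c, t and d. *)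
Section WeylCase.
Variables (k : fieldType) (c : k).
Hypothesis c_neq0 : c != 0.

Let T := weyl_algebra_over_line k.
Let scal : {rmorphism {poly k} -> T} := presented_scalar (@weyl_relation k).
Let i : {rmorphism k -> T} := scal \o polyC.
Let t : T := presented_gen (@weyl_relation k) ord0.
Let d : T := presented_gen (@weyl_relation k) ord_max.

Definition weyl_gens (j : 'I_3) : T :=
  if val j == 0%N then scal (c^-1%:P * 'X) else if val j == 1%N then t else d.

Let weyl_gen0 : weyl_gens (inord 0) = scal (c^-1%:P * 'X).
Proof. by rewrite /weyl_gens /= inordK. Qed.
Let weyl_gen1 : weyl_gens (inord 1) = t.
Proof. by rewrite /weyl_gens /= inordK. Qed.
Let weyl_gen2 : weyl_gens (inord 2) = d.
Proof. by rewrite /weyl_gens /= inordK. Qed.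

Let scalX : i c * weyl_gens (inord 0) = scal 'X.
Proof.
rewrite weyl_gen0; apply: etrans (esym (rmorphM scal _ _)) _.
by congr (scal _); rewrite mulrA -polyCM mulfV // polyC1 mul1r.
Qed.

Lemma weyl_rel : d * t = t * d + scal 'X.
Proof.
have piM a b : presented_gen _ a * presented_gen _ b =
    quotient_pi (@weyl_relation k) (free_gen _ a * free_gen _ b).
  exact: esym (rmorphM (quotient_pi _) _ _).
rewrite /d /t !piM; apply: etrans (rmorphD (quotient_pi _) _ _).
by apply/quotient_piE/asboolP => I _; apply; rewrite opprD addrA; constructor.
Qed.

Lemma weyl_degenerate_jackson : degenerate_jackson c i weyl_gens.
Proof.
split=> [e j|||].
- exact: presented_scalar_central.
- by rewrite weyl_gen0; apply: presented_scalar_central.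
- by rewrite weyl_gen0; apply/commr_sym/presented_scalar_central.
- by rewrite scalX weyl_gen1 weyl_gen2 weyl_rel.
Qed.

Lemma weyl_algebra_generated : algebra_generated i weyl_gens.
Proof.
move=> P PC PX PD PM.
have PscalX : P (scal 'X) := eq_ind _ P (PM _ _ (PC c) (PX (inord 0))) _ scalX.
apply: presented_ind (PD) (PM) => [p|j].
  elim/poly_ind: p => [|p e IHp].
    by rewrite -(polyC0 k); apply: PC.
  rewrite (rmorphD scal) (rmorphM scal); apply: (PD); last exact: PC.
  exact: PM IHp PscalX.
case: (eqVneq j ord0) => [->|j0]; first by rewrite -[X in P X]weyl_gen1.
have -> : j = ord_max by apply: val_inj; case: j j0 => [[|[|]]].
by rewrite -[X in P X]weyl_gen2.
Qed.

Lemma weyl_lift (B : pzRingType) (iB : {rmorphism k -> B}) (z : 'I_3 -> B) :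
    degenerate_jackson c iB z ->
  exists G : {rmorphism T -> B},
    (forall e, G (i e) = iB e) /\ (forall j, G (weyl_gens j) = z j).
Proof.
move=> [comC z01 z20 z21].
have comX j : GRing.comm (iB c * z (inord 0)) (z j).
  apply/commr_sym/commrM; first exact/commr_sym/comC.
  by elim/ord3_ind: j => //; apply: commr_sym.
have [|iP [iPC iPX]] := @poly_lift_ex _ _ iB (iB c * z (inord 0)).
  by move=> e; apply: commrM => //; rewrite /GRing.comm -!rmorphM mulrC.
have comP p j : GRing.comm (iP p) (z j).
  by apply: poly_lift_comm p => [e|]; rewrite ?iPC ?iPX.
pose g (j : 'I_2) := if j == ord0 then z (inord 1) else z (inord 2).
have [] := @presented_lift_ex _ _ (@weyl_relation k) _ iP g.
- by move=> p j; rewrite /g; case: ifP.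
- move=> F FZ Fgen s [].
  have FM a b : F (free_gen _ a * free_gen _ b) = g a * g b.
    by rewrite -!Fgen; apply: rmorphM.
  transitivity (z (inord 2) * z (inord 1) - z (inord 1) * z (inord 2)
    - iB c * z (inord 0)).
    rewrite 2!(rmorphB F); congr (_ - _ - _); [exact: FM | exact: FM |].
    by apply: etrans (FZ _ _) _; rewrite (rmorph1 F) mulr1 iPX.
  by rewrite z21 addrAC addrK subrr.
move=> G [GC GX]; exists G; split=> [e|j].
  exact: etrans (GC _) (iPC e).
elim/ord3_ind: j.
- rewrite weyl_gen0; apply: etrans (GC _) _; rewrite rmorphM iPC iPX mulrA.
  by rewrite -rmorphM mulVf // rmorph1 mul1r.
- by rewrite weyl_gen1; apply: GX.
- by rewrite weyl_gen2; apply: GX.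
Qed.

Lemma jackson_weyl_iso (R : comNzRingType) (f : {rmorphism R -> k})
    (zeta x : R) (r : nat) : f zeta = 1 -> f x = c ->
  isomorphic_algebras (base_change_scalar f (jackson_scalar zeta x r))
    (@weyl_scalar k).
Proof.
move=> fz fx.
have deg : degenerate_jackson (f x) i weyl_gens.
  by rewrite fx; apply: weyl_degenerate_jackson.
have [||F [F_bij FC]] :=
    @base_change_jackson_iso R k f zeta x r T i weyl_gens fz deg.
- exact: weyl_algebra_generated.
- by rewrite fx => B iB z zB _; apply: weyl_lift.
by exists F; split.
Qed.
End WeylCase.

(** For c = 0 the three generators commute pairwise, so every algebra that they
generate is commutative and receives a morphism from the polynomial ring. *)
Lemma jackson_mpoly_iso (k : fieldType) (R : comNzRingType)
    (f : {rmorphism R -> k}) (zeta x : R) (r : nat) :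
    f zeta = 1 -> f x = 0 ->
  isomorphic_algebras (B := {mpoly k[3]})
    (base_change_scalar f (jackson_scalar zeta x r)) (@mpolyC 3 k).
Proof.
move=> fz fx.
apply: (@base_change_jackson_iso R k f zeta x r {mpoly k[3]} (@mpolyC 3 k)
  (fun j => 'X_j)) => //.
- by rewrite fx; split=> [e j|||]; rewrite /GRing.comm ?mpolyC0 ?mul0r ?addr0
    // mulrC.
- move=> P PC PX PD PM; elim/mpolyind => [|e m p _ _ IHp].
    by rewrite -(mpolyC0 3 k); apply: PC.
  apply: (PD) => //; rewrite -mul_mpolyC; apply: (PM); first exact: PC.
  have P1 : P 1 by rewrite -(mpolyC1 3 k); apply: PC.
  rewrite mpolyXE_id; apply: (big_ind P) => // j _.
  elim: (m j) => [|n IHn]; first by rewrite expr0.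
  by rewrite exprS; apply: PM.
rewrite fx => B iB z [comC z01 z20 z21] genB.
have comz j l : GRing.comm (z j) (z l).
  have z21' : GRing.comm (z (inord 2)) (z (inord 1)).
    by rewrite /GRing.comm z21 rmorph0 mul0r addr0.
  by elim/ord3_ind: j; elim/ord3_ind: l => //; apply: commr_sym.
apply: mpoly_lift_ex => //.
suff comB a j : GRing.comm a (z j).
  move=> a b; apply: (genB (fun b => GRing.comm a b)) => [c|j|u v|u v].
  - apply: (genB (fun a => GRing.comm a (iB c))) => [e|j|u v|u v].
    + by rewrite /GRing.comm -!rmorphM mulrC.
    + exact/commr_sym/comC.
    + by move=> uc vc; apply/commr_sym/commrD; apply/commr_sym.
    + by move=> uc vc; apply/commr_sym/commrM; apply/commr_sym.
  - exact: comB.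
  - exact: commrD.
  - exact: commrM.
apply: (genB (fun a => GRing.comm a (z j))) => [c|l|u v|u v] //.
  by move=> uc vc; apply/commr_sym/commrD; apply/commr_sym.
by move=> uc vc; apply/commr_sym/commrM; apply/commr_sym.
Qed.

(** * The group law on a short Weierstrass cubic *)

Section ShortLaw.
Variables (F : fieldType) (a2 a4 a6 : F).

Definition short_curve : weierstrass F := Weierstrass 0 a2 0 a4 a6.

Lemma on_shortP x y :
  on_curve short_curve (Affine x y) <->
  y ^+ 2 = x ^+ 3 + a2 * x ^+ 2 + a4 * x + a6.
Proof.
rewrite /= /weq /= !mul0r !addr0; split=> [/eqP|->]; last by rewrite subrr.
by rewrite subr_eq0 => /eqP.
Qed.

(** The slope of a chord satisfies the first equation and the slope of a tangent
the second.  On the curve each equation implies the other one wherever it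
determines the slope, so both may be required of chords and tangents alike. *)
Definition slope_spec (x1 y1 x2 y2 l : F) : Prop :=
  l * (x2 - x1) = y2 - y1 /\
  l * (y1 + y2) = x1 ^+ 2 + x1 * x2 + x2 ^+ 2 + a2 * (x1 + x2) + a4.

Definition chord_sum (x1 y1 x2 l : F) : point F :=
  let x3 := l ^+ 2 - a2 - x1 - x2 in Affine x3 (- (l * (x3 - x1) + y1)).

Lemma addpt_opposite x y :
  addpt short_curve (Affine x y) (Affine x (- y)) = Infinity.
Proof. by rewrite /= eqxx mul0r !addr0 subrr eqxx. Qed.

Lemma curve_same_abscissa x y1 y2 :
    on_curve short_curve (Affine x y1) -> on_curve short_curve (Affine x y2) ->
  y2 = - y1 \/ y1 = y2.
Proof.
move=> /on_shortP E1 /on_shortP E2.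
have /eqP : (y1 + y2) * (y1 - y2) = 0.
  transitivity (y1 ^+ 2 - y2 ^+ 2); first by ring.
  by rewrite E1 E2 subrr.
rewrite mulf_eq0 subr_eq0 addrC addr_eq0 => /orP[/eqP|/eqP]; by [left|right].
Qed.

Lemma curve_difference x1 y1 x2 y2 :
    on_curve short_curve (Affine x1 y1) ->
    on_curve short_curve (Affine x2 y2) ->
  (y2 - y1) * (y1 + y2) =
  (x2 - x1) * (x1 ^+ 2 + x1 * x2 + x2 ^+ 2 + a2 * (x1 + x2) + a4).
Proof.
move=> /on_shortP E1 /on_shortP E2.
have -> : (y2 - y1) * (y1 + y2) = y2 ^+ 2 - y1 ^+ 2 by ring.
by rewrite E1 E2; ring.
Qed.

Lemma slope_exists x1 y1 x2 y2 :
    on_curve short_curve (Affine x1 y1) ->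
    on_curve short_curve (Affine x2 y2) ->
    (x1 != x2) || (y1 + y2 != 0) ->
  exists l, slope_spec x1 y1 x2 y2 l.
Proof.
move=> c1 c2; have [eqx|nex _] := eqVneq x1 x2.
  rewrite -eqx in c2 *; rewrite /= => y12.
  exists ((x1 ^+ 2 + x1 * x1 + x1 ^+ 2 + a2 * (x1 + x1) + a4) / (y1 + y2)).
  split; last by rewrite divfK.
  rewrite subrr mulr0.
  have [E|->] := curve_same_abscissa c1 c2; last by rewrite subrr.
  by rewrite E subrr eqxx in y12.
have dx : x2 - x1 != 0 by rewrite subr_eq0 eq_sym.
exists ((y2 - y1) / (x2 - x1)); split; first by rewrite divfK.
apply: (mulIf dx); rewrite mulrAC divfK // (curve_difference c1 c2).
by rewrite mulrC.
Qed.

Lemma addpt_short x1 y1 x2 y2 l :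
    on_curve short_curve (Affine x1 y1) ->
    (x1 != x2) || (y1 + y2 != 0) -> slope_spec x1 y1 x2 y2 l ->
  addpt short_curve (Affine x1 y1) (Affine x2 y2) = chord_sum x1 y1 x2 l.
Proof.
move=> c1 neg [l1 l2]; rewrite /= !mul0r !addr0 !subr0.
have -> /= : (x1 == x2) && (y1 + y2 == 0) = false.
  by case: eqP neg => //= _ /negPf.
have [eqx|nex] := eqVneq x1 x2.
  rewrite -eqx in l1 l2 neg *.
  move: l1; rewrite subrr mulr0 => /esym/eqP; rewrite subr_eq0 => /eqP eqy.
  rewrite eqxx eqy /= in neg l2 *.
  have y1d : 2%:R * y1 != 0 by rewrite mulr_natl mulr2n.
  rewrite /chord_sum.
  have -> : (3%:R * x1 ^+ 2 + 2%:R * a2 * x1 + a4) / (2%:R * y1) = l.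
    apply: (mulIf y1d); rewrite divfK //.
    have -> : l * (2%:R * y1) = l * (y1 + y1) by ring.
    by rewrite l2; ring.
  have -> : (- x1 ^+ 3 + a4 * x1 + 2%:R * a6) / (2%:R * y1) = y1 - l * x1.
    apply: (mulIf y1d); rewrite divfK //.
    have -> : (y1 - l * x1) * (2%:R * y1) =
        2%:R * y1 ^+ 2 - x1 * (l * (y1 + y1)).
      by ring.
    by rewrite l2 ((on_shortP _ _).1 c1); ring.
  by congr Affine; ring.
have dx : x2 - x1 != 0 by rewrite subr_eq0 eq_sym.
have -> : (y2 - y1) / (x2 - x1) = l by rewrite -l1 mulfK.
have -> : (y1 * x2 - y2 * x1) / (x2 - x1) = y1 - l * x1.
  apply: (mulIf dx); rewrite divfK //.
  have -> : (y1 - l * x1) * (x2 - x1) = y1 * (x2 - x1) - x1 * (l * (x2 - x1)).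
    by ring.
  by rewrite l1; ring.
by rewrite /chord_sum; congr Affine; ring.
Qed.

(** The cubic minus the square of the line has roots x1 and x2, hence also the
third abscissa given by the sum of the roots. *)
Lemma chord_sum_on_curve x1 y1 x2 y2 l :
    on_curve short_curve (Affine x1 y1) -> slope_spec x1 y1 x2 y2 l ->
  on_curve short_curve (chord_sum x1 y1 x2 l).
Proof.
move=> /on_shortP c1 [l1 l2]; apply/on_shortP.
set x3 := l ^+ 2 - a2 - x1 - x2.
apply/eqP; rewrite -subr_eq0; apply/eqP.
transitivity ((y1 ^+ 2 - (x1 ^+ 3 + a2 * x1 ^+ 2 + a4 * x1 + a6))
  + (x3 - x1) * (l * (y1 + y2)
      - (x1 ^+ 2 + x1 * x2 + x2 ^+ 2 + a2 * (x1 + x2) + a4))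
  + (x3 - x1) * l * (l * (x2 - x1) - (y2 - y1))).
  by rewrite /x3; ring.
by rewrite l1 l2 c1 !subrr !mulr0 !addr0.
Qed.

Lemma addpt_on_curve P Q :
    on_curve short_curve P -> on_curve short_curve Q ->
  on_curve short_curve (addpt short_curve P Q).
Proof.
case: P => [|x1 y1] //; case: Q => [|x2 y2] // c1 c2.
have [/andP[/eqP -> ]|] := boolP ((x1 == x2) && (y1 + y2 == 0)).
  by rewrite addrC addr_eq0 => /eqP ->; rewrite addpt_opposite.
rewrite negb_and => neg; have [l lP] := slope_exists c1 c2 neg.
by rewrite (addpt_short c1 neg lP); apply: chord_sum_on_curve c1 lP.
Qed.

Lemma mulpt_on_curve n P :
  on_curve short_curve P -> on_curve short_curve (mulpt short_curve n P).
Proof. by move=> cP; elim: n => //= n; apply: addpt_on_curve. Qed.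

End ShortLaw.

(** * Changes of Weierstrass coordinates *)

Section ChangeOfVariables.
Variable F : fieldType.

(** [isomorphic_curve W W'] with its parameters exposed. *)
Definition is_change (W W' : weierstrass F) (u r s t : F) : Prop :=
  u != 0 /\
  [/\ u * wa1 W' = wa1 W + 2%:R * s,
      u ^+ 2 * wa2 W' = wa2 W - s * wa1 W + 3%:R * r - s ^+ 2,
      u ^+ 3 * wa3 W' = wa3 W + r * wa1 W + 2%:R * t,
      u ^+ 4 * wa4 W' = wa4 W - s * wa3 W + 2%:R * r * wa2 W
                        - (t + r * s) * wa1 W + 3%:R * r ^+ 2 - 2%:R * s * t
    & u ^+ 6 * wa6 W' = wa6 W + r * wa4 W + r ^+ 2 * wa2 W + r ^+ 3
                        - t * wa3 W - t ^+ 2 - r * t * wa1 W].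

Lemma is_change_solve W W' u r s t : is_change W W' u r s t ->
  [/\ wa1 W = u * wa1 W' - 2%:R * s,
      wa2 W = u ^+ 2 * wa2 W' + s * wa1 W - 3%:R * r + s ^+ 2,
      wa3 W = u ^+ 3 * wa3 W' - r * wa1 W - 2%:R * t,
      wa4 W = u ^+ 4 * wa4 W' + s * wa3 W - 2%:R * r * wa2 W
              + (t + r * s) * wa1 W - 3%:R * r ^+ 2 + 2%:R * s * t
    & wa6 W = u ^+ 6 * wa6 W' - r * wa4 W - r ^+ 2 * wa2 W - r ^+ 3
              + t * wa3 W + t ^+ 2 + r * t * wa1 W].
Proof. by case=> _ [-> -> -> -> ->]; split; ring. Qed.

Lemma is_change_trans W W1 W2 u r s t u' r' s' t' :
    is_change W W1 u r s t -> is_change W1 W2 u' r' s' t' ->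
  is_change W W2 (u * u') (r + u ^+ 2 * r') (s + u * s')
    (t + u ^+ 3 * t' + u ^+ 2 * s * r').
Proof.
move=> H H'; have [u0 _] := H; have [u0' _] := H'.
have [E1 E2 E3 E4 E6] := is_change_solve H.
have [E1' E2' E3' E4' E6'] := is_change_solve H'.
split; first by rewrite mulf_neq0.
by split; rewrite ?E6 ?E4 ?E3 ?E2 ?E1 ?E6' ?E4' ?E3' ?E2' ?E1'; ring.
Qed.

Definition change_point (u r s t : F) (P : point F) : point F :=
  if P is Affine x y
  then Affine ((x - r) / u ^+ 2) ((y - s * (x - r) - t) / u ^+ 3)
  else Infinity.

Lemma weq_change W W' u r s t x y : is_change W W' u r s t ->
  weq W (u ^+ 2 * x + r) (u ^+ 3 * y + u ^+ 2 * s * x + t)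
    = u ^+ 6 * weq W' x y.
Proof.
move=> H; have [E1 E2 E3 E4 E6] := is_change_solve H.
by rewrite /weq ?E6 ?E4 ?E3 ?E2 ?E1; ring.
Qed.

Lemma change_pointP u r s t x y : u != 0 ->
  exists x' y', change_point u r s t (Affine x y) = Affine x' y' /\
    x = u ^+ 2 * x' + r /\ y = u ^+ 3 * y' + u ^+ 2 * s * x' + t.
Proof.
move=> u0; do 2!eexists; split; first by [].
by split; field.
Qed.

Lemma on_curve_change W W' u r s t P : is_change W W' u r s t ->
  on_curve W' (change_point u r s t P) <-> on_curve W P.
Proof.
case: P => [|x y] // H; have [u0 _] := H.
have [x' [y' [-> [-> ->]]]] := change_pointP r s t x y u0.
rewrite /= (weq_change _ _ H); split=> [->|/eqP]; first by rewrite mulr0.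
by rewrite mulf_eq0 expf_eq0 (negPf u0) => /eqP.
Qed.

Section ToShort.
Variables (W : weierstrass F) (a2 a4 a6 u r s t : F).
Let W' := short_curve a2 a4 a6.
Hypothesis WW' : is_change W W' u r s t.
Let tau := change_point u r s t.

Let u0 : u != 0. Proof. by case: WW'. Qed.

(** A change of variables is affine, so it maps lines to lines and slopes l to
(l - s) / u. *)
Lemma addpt_change P Q : on_curve W P -> on_curve W Q ->
  tau (addpt W P Q) = addpt W' (tau P) (tau Q).
Proof.
case: P => [|x1 y1] //; case: Q => [|x2 y2] // c1W.
have /(on_curve_change _ WW').2 c1 := c1W.
move=> c2W; have /(on_curve_change _ WW').2 c2 := c2W.
have [E1 E2 E3 E4 E6] := is_change_solve WW'.
rewrite -/tau in c1 c2; rewrite /tau in c1 c2 *.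
have [X1 [Y1 [e1 [ex1 ey1]]]] := change_pointP r s t x1 y1 u0.
have [X2 [Y2 [e2 [ex2 ey2]]]] := change_pointP r s t x2 y2 u0.
rewrite e1 in c1 *; rewrite e2 in c2 *.
have u2 : u ^+ 2 != 0 by rewrite expf_neq0.
have u3 : u ^+ 3 != 0 by rewrite expf_neq0.
have eqx : (x1 == x2) = (X1 == X2).
  by rewrite ex1 ex2 (inj_eq (addIr _)) (inj_eq (mulfI u2)).
have eqy : x1 = x2 -> y1 + y2 + wa1 W * x2 + wa3 W = u ^+ 3 * (Y1 + Y2).
  rewrite ex1 ex2 => /addIr/(mulfI u2) e.
  by rewrite ey1 ey2 E3 E1 e /=; ring.
have [/andP[/eqP X12 Y12]|] := boolP ((X1 == X2) && (Y1 + Y2 == 0)).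
  have x12 : x1 = x2 by apply/eqP; rewrite eqx X12.
  rewrite X12 in c1 *; move: Y12; rewrite addrC addr_eq0 => /eqP Y12.
  rewrite Y12 addpt_opposite /= eqx X12 eqxx eqy // Y12.
  by rewrite subrr mulr0 eqxx.
rewrite negb_and => neg; have [L LP] := slope_exists c1 c2 neg.
rewrite (addpt_short c1 neg LP) /=.
have -> : (x1 == x2) && (y1 + y2 + wa1 W * x2 + wa3 W == 0) = false.
  case: eqP => //= x12; rewrite eqy // mulf_eq0 (negPf u3) /=.
  by move: neg; rewrite -eqx x12 eqxx => /negPf.
have [L1 L2] := LP.
have dE : x1 = x2 ->
    2%:R * y1 + wa1 W * x1 + wa3 W = u ^+ 3 * (Y1 + Y1) /\ Y1 + Y1 != 0.
  move=> x12; have X12 : X1 = X2 by apply/eqP; rewrite -eqx x12.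
  have Y12 : Y2 = Y1 by apply/eqP; rewrite -subr_eq0 -L1 X12 subrr mulr0.
  split; last by move: neg; rewrite X12 eqxx Y12.
  by rewrite ey1 ex1 E3 E1 /=; ring.
set l := if x1 == x2 then _ / _ else _.
have lE : l = u * L + s.
  rewrite /l; case: eqP => x12.
    have X12 : X1 = X2 by apply/eqP; rewrite -eqx x12.
    have Y12 : Y2 = Y1 by apply/eqP; rewrite -subr_eq0 -L1 X12 subrr mulr0.
    have [d Yd] := dE x12.
    rewrite d; apply: (mulIf (mulf_neq0 u3 Yd)); rewrite divfK ?mulf_neq0 //.
    transitivity (u ^+ 4 * (L * (Y1 + Y2)) + s * (u ^+ 3 * (Y1 + Y1))).
      by rewrite L2 -X12 E4 E3 E2 E1 ey1 ex1 /=; ring.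
    by rewrite Y12; ring.
  have x21 : x2 - x1 != 0 by rewrite subr_eq0 eq_sym; apply/eqP.
  apply: (mulIf x21); rewrite divfK //.
  transitivity (u ^+ 3 * (L * (X2 - X1)) + s * (x2 - x1)).
    by rewrite L1 ey1 ey2 ex1 ex2; ring.
  by rewrite ex1 ex2; ring.
set m := if x1 == x2 then _ / _ else _.
have mE : m = y1 - l * x1.
  rewrite /m /l; case: eqP => x12.
    have [d Yd] := dE x12.
    have d0 : 2%:R * y1 + wa1 W * x1 + wa3 W != 0 by rewrite d mulf_neq0.
    apply: (mulIf d0); rewrite (divfK d0) mulrBl [_ * x1 * _]mulrAC (divfK d0).
    apply/eqP; rewrite -subr_eq0; apply/eqP.
    transitivity (- 2%:R * weq W x1 y1); first by rewrite /weq; ring.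
    by rewrite c1W mulr0.
  have x21 : x2 - x1 != 0 by rewrite subr_eq0 eq_sym; apply/eqP.
  by field.
rewrite mE lE ex1 ex2 ey1 /chord_sum E3 E2 E1 /=.
congr Affine; field; exact: u0.
Qed.

Lemma addpt_on_curve_change P Q :
  on_curve W P -> on_curve W Q -> on_curve W (addpt W P Q).
Proof.
move=> cP cQ; apply/(on_curve_change _ WW'); rewrite -/tau addpt_change //.
by apply: addpt_on_curve; apply/(on_curve_change _ WW').
Qed.

Lemma mulpt_change n P : on_curve W P ->
  on_curve W (mulpt W n P) /\ tau (mulpt W n P) = mulpt W' n (tau P).
Proof.
move=> cP; elim: n => [|n [cn IHn]] //=.
by split; [apply: addpt_on_curve_change | rewrite addpt_change // IHn].
Qed.

Lemma torsion_change n P :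
  torsion_point W n P <-> torsion_point W' n (tau P).
Proof.
rewrite /torsion_point (on_curve_change P WW').
split=> -[cP nP]; have [_ nE] := mulpt_change n cP; split=> //.
  by rewrite -nE nP.
by move: nP; rewrite -nE; case: (mulpt W n P).
Qed.

Lemma change_point_surj x y : exists P, tau P = Affine x y.
Proof.
exists (Affine (u ^+ 2 * x + r) (u ^+ 3 * y + u ^+ 2 * s * x + t)).
by congr Affine; field.
Qed.
End ToShort.
End ChangeOfVariables.

(** * Valuations *)

Section Valuation.
Variables (K : fieldType) (v : dvaluation K).

Lemma vge_le m n x : m <= n -> x \in vge v n -> x \in vge v m.
Proof.
rewrite !inE => le_mn /orP[->//|le_nx].
by rewrite (le_trans le_mn le_nx) orbT.
Qed.

Lemma vgeM m n x y : x \in vge v m -> y \in vge v n -> x * y \in vge v (m + n).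
Proof.
rewrite !inE mulf_eq0; case: (eqVneq x 0) => //= x0.
by case: (eqVneq y 0) => //= y0 lex ley; rewrite dvalM // lerD.
Qed.

Lemma vgeD n x y : x \in vge v n -> y \in vge v n -> x + y \in vge v n.
Proof.
rewrite !inE; case: (eqVneq x 0) => [->|x0]; first by rewrite add0r.
case: (eqVneq y 0) => [->|y0]; first by rewrite addr0 (negPf x0).
case: (eqVneq (x + y) 0) => //= xy0 lex ley.
by apply: (le_trans _ (dvalD v x0 y0 xy0)); rewrite le_min lex ley.
Qed.

Lemma vgeMl n x y : x \in vge v 0 -> y \in vge v n -> x * y \in vge v n.
Proof. by move=> ox ny; have := vgeM ox ny; rewrite add0r. Qed.

Lemma vgeN n x : x \in vge v n -> - x \in vge v n.
Proof. by move=> nx; rewrite -mulN1r vgeMl // inE dvalN1 lexx orbT. Qed.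

Lemma dvalX n x : x != 0 -> v (x ^+ n) = v x *+ n.
Proof.
move=> x0; elim: n => [|n IHn]; first by rewrite dval1.
by rewrite exprS mulrS dvalM ?expf_neq0 // IHn.
Qed.

Lemma dvalV x : x != 0 -> v x^-1 = - v x.
Proof.
move=> x0; apply/eqP; rewrite -addr_eq0 addrC.
by rewrite -dvalM ?invr_eq0 // divff // dval1.
Qed.

Lemma nvint x : x \notin vge v 0 -> x != 0 /\ v x < 0.
Proof. by rewrite inE negb_or -ltNge => /andP. Qed.

Lemma vintX n x : x ^+ n.+1 \in vge v 0 -> x \in vge v 0.
Proof.
rewrite !inE expf_eq0 /=; case: (eqVneq x 0) => //= x0.
by rewrite dvalX // pmulrn_lge0.
Qed.

Lemma vge1X n x : x ^+ n.+1 \in vge v 1 -> x \in vge v 1.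
Proof.
rewrite !inE expf_eq0 /=; case: (eqVneq x 0) => //= x0.
rewrite dvalX // -[1 in X in X -> _]add0r -[1 in X in _ -> X]add0r !lezD1.
by rewrite pmulrn_lgt0.
Qed.

(** The ultrametric inequality is an equality when one term dominates. *)
Lemma dvalD_dominant x y : x != 0 -> y \in vge v (v x + 1) ->
  x + y != 0 /\ v (x + y) = v x.
Proof.
move=> x0; rewrite inE; case: (eqVneq y 0) => [-> _|y0 /= ltxy].
  by rewrite addr0.
have xy0 : x + y != 0.
  rewrite addr_eq0; apply/negP=> /eqP xE; move: ltxy.
  by rewrite xE -mulN1r dvalM ?oppr_eq0 ?oner_neq0 // dvalN1 add0r lezD1 ltxx.
split=> //; apply/eqP; rewrite eq_le; apply/andP; split; last first.
  apply: le_trans (dvalD v x0 y0 xy0); rewrite le_min lexx /=.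
  by apply: le_trans ltxy; rewrite lerDl.
have ny0 : - y != 0 by rewrite oppr_eq0.
have := @dvalD _ v _ _ xy0 ny0; rewrite addrK => /(_ x0).
rewrite -[- y]mulN1r dvalM ?oppr_eq0 ?oner_neq0 // dvalN1 add0r.
rewrite ge_min => /orP[//|lexy].
by have := le_trans ltxy lexy; rewrite lezD1 ltxx.
Qed.

Definition vunit x := (x != 0) && (v x == 0).

Lemma vunitV_int x : vunit x -> x^-1 \in vge v 0.
Proof. by case/andP=> x0 /eqP vx; rewrite inE dvalV // vx oppr0 lexx orbT. Qed.

Lemma vunit_int x : vunit x -> x \in vge v 0.
Proof. by case/andP=> x0 /eqP vx; rewrite inE vx lexx orbT. Qed.

Lemma vunitM x y : vunit x -> vunit y -> vunit (x * y).
Proof.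
move=> /andP[x0 /eqP vx] /andP[y0 /eqP vy].
by rewrite /vunit mulf_neq0 //= dvalM // vx vy.
Qed.

Lemma vunitV x : vunit x -> vunit x^-1.
Proof.
by move=> /andP[x0 /eqP vx]; rewrite /vunit invr_eq0 x0 dvalV // vx oppr0 /=.
Qed.

Lemma vunitX n x : vunit x -> vunit (x ^+ n).
Proof.
by move=> /andP[x0 /eqP vx]; rewrite /vunit expf_neq0 //= dvalX // vx mul0rn.
Qed.

Lemma vunitD x y : vunit x -> y \in vge v 1 -> vunit (x + y).
Proof.
move=> /andP[x0 /eqP vx] y1.
have [] := @dvalD_dominant x y x0; first by rewrite vx.
by rewrite /vunit => -> -> /=; rewrite vx.
Qed.

Lemma vint_nat n : n%:R \in vge v 0. Proof. exact: rpred_nat. Qed.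

Section Padic.
Variable p : nat.
Hypotheses (p_prime : prime p) (vp : v p%:R = 1).

(** A Bezout relation a n = b p + 1 excludes that n and p both lie in the
maximal ideal. *)
Lemma vunit_nat n : (0 < n < p)%N -> vunit n%:R.
Proof.
move=> /andP[n_gt0 lt_np].
have p1 : p%:R \in vge v 1 by rewrite inE vp lexx orbT.
have n1 : n%:R \notin vge v 1.
  apply/negP=> n1.
  have /eqP cop : coprime n p by rewrite coprime_sym prime_coprime // gtnNdvd.
  case: (egcdnP p n_gt0) => a b E _; rewrite cop in E.
  have: 1 \in vge v 1.
    have -> : 1 = a%:R * n%:R - b%:R * p%:R :> K.
      by rewrite -!natrM E natrD addrAC subrr add0r.
    by apply: vgeD; [|apply: vgeN]; apply: vgeMl => //; apply: vint_nat.
  by rewrite inE oner_eq0 dval1.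
have := vint_nat n; move: n1; rewrite !inE negb_or => /andP[n0 nv].
rewrite (negPf n0) /vunit n0 /= => nv0.
by rewrite eq_le nv0 andbT -ltzD1 add0r ltNge.
Qed.
End Padic.
End Valuation.

(** * The kernel of reduction has no p-torsion *)

Section AdditiveReduction.
Variables (K : fieldType) (v : dvaluation K).

Definition cong2 (a b : K) := a - b \in vge v 2.
Local Notation "a ~= b" := (cong2 a b) (at level 70).
Local Notation int_ring := (vge v 0).

Lemma cong2_int a b : a ~= b -> b \in int_ring -> a \in int_ring.
Proof.
by move=> ab ob; rewrite -(subrK b a) vgeD // (vge_le _ ab).
Qed.

Lemma cong2D a b c d : a ~= b -> c ~= d -> a + c ~= b + d.
Proof.
rewrite /cong2 => ab cd; have -> : a + c - (b + d) = (a - b) + (c - d) by ring.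
exact: vgeD.
Qed.

Lemma cong2N a b : a ~= b -> - a ~= - b.
Proof.
rewrite /cong2 => ab; have -> : - a - - b = - (a - b) by ring.
exact: vgeN.
Qed.

Lemma cong2M a b c d : a \in int_ring -> d \in int_ring ->
  a ~= b -> c ~= d -> a * c ~= b * d.
Proof.
rewrite /cong2 => oa od ab cd.
have -> : a * c - b * d = a * (c - d) + d * (a - b) by ring.
by apply: vgeD; apply: vgeMl.
Qed.

Lemma cong2_trans b a c : a ~= b -> b ~= c -> a ~= c.
Proof. by rewrite /cong2 => ab bc; rewrite -(subrKA b); apply: vgeD. Qed.

Lemma cong2_unit a b : a ~= b -> vunit v b -> vunit v a.
Proof.
by move=> ab ub; rewrite -(subrKC b a) vunitD // (vge_le _ ab).
Qed.

Variables (a2 a4 a6 : K).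
Hypotheses (a2J : a2 \in vge v 2) (a4J : a4 \in vge v 2).
Let W := short_curve a2 a4 a6.

(** The nonsingular points of the cusp y^2 = x^3 form the additive group under
N |-> (N^-2, N^-3); this is one step of addition modulo the square of the
maximal ideal, where the curve W is that cusp. *)
Lemma additive_addpt (N h x2 y2 : K) :
    vunit v N -> vunit v (N + 1) -> h ~= 1 -> x2 ~= N ^- 2 -> y2 ~= N ^- 3 ->
    on_curve W (Affine h h) -> on_curve W (Affine x2 y2) ->
  exists x3 y3, [/\ addpt W (Affine h h) (Affine x2 y2) = Affine x3 y3,
    x3 ~= (N + 1) ^- 2 & y3 ~= (N + 1) ^- 3].
Proof.
move=> uN uN1 h1 ex ey cP cQ.
have /andP[N0 _] := uN; have /andP[N10 _] := uN1.
have o1 : 1 \in int_ring by apply: rpred1.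
have oN n : N ^- n \in int_ring by rewrite vunit_int // vunitV // vunitX.
have oN1 n : (N + 1) ^- n \in int_ring by rewrite vunit_int // vunitV // vunitX.
have oh := cong2_int h1 o1.
have ox := cong2_int ex (oN 2%N).
have oy := cong2_int ey (oN 3%N).
(* The sum of the two equations of the slope reads l (x2 + y2) = ..., and this
   coefficient is a unit for the chord and for the tangent. *)
have DD : x2 + y2 ~= (N + 1) * N ^- 3.
  by have -> : (N + 1) * N ^- 3 = N ^- 2 + N ^- 3; [field | apply: cong2D].
have uD : vunit v (x2 + y2).
  by apply: cong2_unit DD _; rewrite vunitM // vunitV // vunitX.
have /andP[D0 _] := uD.
have neg : (h != x2) || (h + y2 != 0).
  by case: eqP => //= ->.
have [l lP] := slope_exists cP cQ neg; have [l1 l2] := lP.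
rewrite (addpt_short cP neg lP).
(* The slope of the line through (1, 1) and (N^-2, N^-3) on the cusp. *)
pose l0 := (N ^+ 2 + N + 1) * N^-1 * (N + 1)^-1.
have ol0 : l0 \in int_ring.
  have -> : l0 = 1 + N^-1 * (N + 1)^-1 by rewrite /l0; field; apply/andP.
  by rewrite rpredD // rpredM // -[_^-1]expr1 exprVn.
have ll0 : l ~= l0.
  have lD : l * (x2 + y2) = (y2 - h) + h ^+ 2 + h * x2 + x2 ^+ 2
      + (a2 * (h + x2) + a4).
    have -> : l * (x2 + y2) = l * (x2 - h) + l * (h + y2) by ring.
    by rewrite l1 l2; ring.
  have E : l - l0 = (x2 + y2)^-1 * (l * (x2 + y2) - l0 * (x2 + y2)).
    by field.
  rewrite /cong2 E; apply: vgeMl; first by rewrite vunitV_int.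
  have oa : a2 * (h + x2) + a4 ~= 0.
    by rewrite /cong2 subr0; apply: vgeD => //; rewrite mulrC vgeMl // rpredD.
  apply: (@cong2_trans ((N ^- 3 - 1) + 1 ^+ 2 + 1 * N ^- 2 + N ^- 2 ^+ 2 + 0)).
    rewrite lD; do !apply: cong2D => //; first exact: cong2N.
    - by rewrite !expr2; apply: cong2M.
    - by apply: cong2M.
    - by rewrite [x2 ^+ 2]expr2 [_ ^+ 2 in X in _ ~= X]expr2; apply: cong2M.
  have -> : (N ^- 3 - 1) + 1 ^+ 2 + 1 * N ^- 2 + N ^- 2 ^+ 2 + 0 =
      l0 * ((N + 1) * N ^- 3) by rewrite /l0; field; apply/andP.
  rewrite /cong2 -mulrBr vgeMl // -opprB vgeN //.
have ol := cong2_int ll0 ol0.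
set x3 := l ^+ 2 - a2 - h - x2.
have x3E : x3 ~= (N + 1) ^- 2.
  have -> : (N + 1) ^- 2 = l0 ^+ 2 - 0 - 1 - N ^- 2.
    by rewrite /l0; field; apply/andP.
  do 3?[apply: cong2D; last apply: cong2N => //]; last by rewrite /cong2 subr0.
  by rewrite !expr2; apply: cong2M.
exists x3, (- (l * (x3 - h) + h)); split=> //.
have -> : (N + 1) ^- 3 = - (l0 * ((N + 1) ^- 2 - 1) + 1).
  by rewrite /l0; field; apply/andP.
apply: cong2N; apply: cong2D => //; apply: cong2M => //.
  by rewrite rpredB.
by apply: cong2D => //; apply: cong2N.
Qed.

Section Torsion.
Variables (p : nat) (h : K).
Hypotheses (p_prime : prime p) (p_gt2 : (2 < p)%N) (vp : v p%:R = 1).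
Hypotheses (p_neq0 : p%:R != 0 :> K).
Hypotheses (h1 : h ~= 1) (cP : on_curve W (Affine h h)).

Lemma additive_mulpt n : (n.+1 < p)%N ->
  exists x y, [/\ mulpt W n.+1 (Affine h h) = Affine x y,
    x ~= n.+1%:R ^- 2 & y ~= n.+1%:R ^- 3].
Proof.
elim: n => [|n IHn] lt_np.
  by exists h, h; rewrite !expr1n invr1.
have [x [y [E ex ey]]] := IHn (ltnW lt_np).
have cQ : on_curve W (Affine x y) by rewrite -E; apply: mulpt_on_curve.
have uN : vunit v n.+1%:R.
  by apply: (vunit_nat p_prime vp); rewrite (ltnW lt_np).
have uN1 : vunit v (n.+1%:R + 1).
  by rewrite natr1; apply: (vunit_nat p_prime vp); rewrite lt_np.
have [x3 [y3 [E3 ex3 ey3]]] := additive_addpt uN uN1 h1 ex ey cP cQ.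
by exists x3, y3; rewrite -natr1 -E3 -E.
Qed.

(** If pP = Infinity then (p-1)P and P have the same abscissa, so (p-1)^2 is
congruent to 1 and p (p - 2) lies in the square of the maximal ideal. *)
Lemma additive_no_torsion : mulpt W p (Affine h h) <> Infinity.
Proof.
have pE : p = p.-2.+2 by case: p p_gt2 => [|[|[]]].
have [|x [y [E ex _]]] := @additive_mulpt p.-2; first by rewrite -ltnS -pE.
have cQ : on_curve W (Affine x y) by rewrite -E; apply: mulpt_on_curve.
have -> : mulpt W p (Affine h h) = addpt W (Affine h h) (Affine x y).
  by rewrite -E -[LHS]/(mulpt W p _) {1}pE.
have [xh|nxh] := eqVneq h x; last first.
  have neg : (h != x) || (h + y != 0) by rewrite nxh.
  have [l lP] := slope_exists cP cQ neg.
  by rewrite (addpt_short cP neg lP).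
move: ex; rewrite -xh => ex; set N := p.-2.+1%:R in ex.
have uN : vunit v N.
  by apply: (vunit_nat p_prime vp); rewrite /= {2}pE.
have NE : N = p%:R - 1 by apply/(canRL (addrK _)); rewrite natr1 -pE.
have ex1 : 1 ~= N ^- 2.
  by apply: cong2_trans ex; rewrite /cong2 -opprB vgeN.
have : p%:R * (p%:R - 2%:R) \in vge v 2.
  have -> : p%:R * (p%:R - 2%:R) = N ^+ 2 * (1 - N ^- 2).
    by rewrite NE; field; rewrite -NE; case/andP: uN.
  by apply: vgeMl => //; apply: rpredX; apply: vunit_int.
have u2 : vunit v (- 2%:R + p%:R).
  apply: vunitD; last by rewrite inE vp lexx orbT.
  rewrite -mulN1r; apply: vunitM; last exact: (vunit_nat p_prime vp).
  by rewrite /vunit oppr_eq0 oner_eq0 dvalN1 eqxx.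
have /andP[n0 /eqP v0] := u2.
rewrite [p%:R - _]addrC inE mulf_eq0 (negPf p_neq0) (negPf n0) /=.
by rewrite dvalM // vp v0.
Qed.
End Torsion.
End AdditiveReduction.

Section IntegralTorsion.
Variables (K : fieldType) (v : dvaluation K) (p : nat).
Hypotheses (p_prime : prime p) (p_gt2 : (2 < p)%N).
Hypotheses (vp : v p%:R = 1) (p_neq0 : p%:R != 0 :> K).
Variables (a2 a4 a6 : K).
Hypotheses (o2 : a2 \in vge v 0) (o4 : a4 \in vge v 0) (o6 : a6 \in vge v 0).
Let W := short_curve a2 a4 a6.

Lemma integral_ordinate x y :
  on_curve W (Affine x y) -> x \in vge v 0 -> y \in vge v 0.
Proof.
move=> /on_shortP cP ox; apply: (@vintX _ _ 1%N); rewrite cP.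
by rewrite !rpredD ?rpredM ?rpredX.
Qed.

(** For nonintegral (x, y) one has v(x) = -2m and v(y) = -3m with m > 0.  The
scaling by tau = x / y, of valuation m, moves the point to (h, h) with
h = x^3 / y^2, and multiplies the coefficients by tau^2, tau^4 and tau^6, which
are divisible by the square of the maximal ideal. *)
Lemma integral_torsion x y :
    on_curve W (Affine x y) -> mulpt W p (Affine x y) = Infinity ->
  x \in vge v 0.
Proof.
move=> cP Ptors; apply/negPn/negP => nox.
have [x0 vx] := nvint nox.
have /on_shortP yE := cP.
have vxX n : x ^+ n \in vge v (v x *+ n) by rewrite inE dvalX // lexx orbT.
have vx3 : v (x ^+ 3) = v x *+ 3 by apply: dvalX.
have [y20 vy2] : y ^+ 2 != 0 /\ v (y ^+ 2) = v x *+ 3.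
  rewrite yE -2!addrA -vx3; apply: dvalD_dominant; first by rewrite expf_neq0.
  have le2 : v (x ^+ 3) + 1 <= v x *+ 2.
    by rewrite vx3 mulrSr -addrA gerDl lezD1.
  have le1 : v x *+ 2 <= v x by rewrite mulr2n gerDl ltW.
  have le0 : v x *+ 2 <= 0 by rewrite (le_trans le1) // ltW.
  apply: vge_le le2 _; apply: vgeD; first exact: vgeMl.
  apply: vgeD; last exact: vge_le le0 _.
  by apply: vge_le le1 _; apply: vgeMl => //; rewrite inE lexx orbT.
have y0 : y != 0 by apply: contra_neq y20 => ->; rewrite expr0n.
pose tau := x / y.
have t0 : tau != 0 by rewrite mulf_neq0 ?invr_eq0.
have vt : tau \in vge v 1.
  apply: (@vge1X _ _ 1%N); rewrite inE expf_eq0 (negPf t0) /=.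
  rewrite /tau expr_div_n dvalM ?invr_eq0 ?expf_neq0 // dvalV // vy2 dvalX //.
  by rewrite (mulrSr _ 2) opprD addrA subrr add0r -[1]add0r lezD1 oppr_gt0.
have tJ n : tau ^+ n.+2 \in vge v 2.
  rewrite -addn2 exprD vgeMl //; last by rewrite expr2; apply: (vgeM vt vt).
  by rewrite rpredX // (vge_le _ vt).
pose W' := short_curve (a2 * tau ^+ 2) (a4 * tau ^+ 4) (a6 * tau ^+ 6).
have WW' : is_change W W' tau^-1 0 0 0.
  by split; [rewrite invr_eq0 | split; rewrite /=; field].
pose h := x ^+ 3 / y ^+ 2.
have hE : change_point tau^-1 0 0 0 (Affine x y) = Affine h h.
  by rewrite /= /h /tau; congr Affine; field; apply/andP.
have [] := (torsion_change WW' p (Affine x y)).1 (conj cP Ptors).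
rewrite hE => cP' Ptors'.
apply: (@additive_no_torsion _ v _ _ _ _ _ p h _ _ _ _ _ cP' Ptors') => //.
- exact: vgeMl.
- exact: vgeMl.
have uh : vunit v h.
  rewrite /vunit /h mulf_neq0 ?invr_eq0 ?expf_neq0 //=.
  rewrite dvalM ?invr_eq0 ?expf_neq0 // dvalV // vy2 vx3.
  exact/eqP/(subrr (v x *+ 3)).
have oh := vunit_int uh.
(* The equation of the curve at (h, h), solved for the deviation of h from 1. *)
have E : h - 1 = - (h ^- 2 * (a2 * tau ^+ 2 * h ^+ 2 + a4 * tau ^+ 4 * h
    + a6 * tau ^+ 6)).
  have /on_shortP hc := cP'; have h0 : h != 0 by case/andP: uh.
  apply: (mulIf (expf_neq0 2 h0)).
  rewrite mulNr mulrAC mulVf ?expf_neq0 // mul1r.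
  transitivity (h ^+ 3 - h ^+ 2); first by ring.
  by rewrite [h ^+ 2 in LHS]hc; ring.
rewrite /cong2 E; apply/vgeN/vgeMl.
  by rewrite vunit_int // vunitV // vunitX.
apply: vgeD; last exact: vgeMl.
by apply: vgeD; rewrite mulrC vgeMl ?rpredX // vgeMl.
Qed.
End IntegralTorsion.

(** * Reduction of points *)

Section Reduction.
Variables (K : fieldType) (v : dvaluation K).
Let o := ring_of_integers v.

(** The inclusion of the valuation ring, as a morphism. *)
Definition int_incl : {rmorphism ring_of_integers v -> K} := val.
Local Notation i := int_incl.

Lemma int_inclP x : x \in vge v 0 -> exists a : o, x = i a.
Proof. by move=> ox; exists (RingOfIntegers ox). Qed.

Lemma int_incl_int (a : o) : i a \in vge v 0. Proof. by case: a. Qed.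

Lemma int_incl_inj : injective i. Proof. exact: val_inj. Qed.

Variables (k : fieldType) (res : {rmorphism o -> k}).
Hypothesis res_ker : forall a, res a = 0 <-> a \in max_ideal v.

Lemma res_unit (a : o) : res a != 0 -> vunit v (i a).
Proof.
move=> ra; have : a \notin max_ideal v.
  by apply/negP => /res_ker/eqP; apply/negP.
have := int_incl_int a; rewrite !inE negb_or => oa /andP[a0 va].
move: oa; rewrite -[int_val a]/(i a) in a0 va *.
rewrite /vunit a0 (negPf a0) /= => oa.
by rewrite eq_le oa andbT -ltzD1 add0r ltNge.
Qed.

Lemma res_div (a b : o) : res b != 0 ->
  exists c, i c * i b = i a /\ res c = res a / res b.
Proof.
move=> rb; have ub := res_unit rb; have /andP[b0 _] := ub.
have [|c cE] := @int_inclP (i a / i b).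
  by rewrite rpredM ?int_incl_int ?vunitV_int.
have E : i c * i b = i a by rewrite -cE divfK.
exists c; split=> //; apply: (mulIf rb); rewrite divfK // -rmorphM.
by congr (res _); apply: int_incl_inj; rewrite rmorphM.
Qed.

Lemma res0_max (a : o) : i a \in vge v 1 -> res a = 0.
Proof. by move=> va; apply/res_ker. Qed.

(** The points that reduce to Infinity are those of the kernel of reduction. *)
Definition reduces (P : point K) (Q : point k) : Prop :=
  match P, Q with
  | Infinity, Infinity => True
  | Affine x y, Infinity => x \notin vge v 0
  | Affine x y, Affine x' y' =>
      exists a b : o, [/\ x = i a, y = i b, res a = x' & res b = y']
  | _, _ => False
  end.

Variables (a2 a4 a6 : o).
Let W := short_curve (i a2) (i a4) (i a6).
Let W' := short_curve (res a2) (res a4) (res a6).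

Lemma curve_ordinate_int x y :
  on_curve W (Affine x y) -> x \in vge v 0 -> y \in vge v 0.
Proof. by apply: integral_ordinate; apply: int_incl_int. Qed.

Lemma on_curve_res (x y : o) :
  on_curve W (Affine (i x) (i y)) -> on_curve W' (Affine (res x) (res y)).
Proof.
move=> /on_shortP cP; apply/on_shortP.
rewrite -!rmorphXn -!rmorphM -!rmorphD; congr (res _); apply: int_incl_inj.
by rewrite !(rmorphXn, rmorphD, rmorphM).
Qed.

(** One of the two equations of the slope has a coefficient that is a unit, so
the slope is integral and its residue is a slope of the reduced points. *)
Lemma reduces_chord (x1 y1 x2 y2 : o) :
    on_curve W (Affine (i x1) (i y1)) -> on_curve W (Affine (i x2) (i y2)) ->
    (res x1 != res x2) || (res y1 + res y2 != 0) ->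
  exists l : o,
    [/\ slope_spec (i a2) (i a4) (i x1) (i y1) (i x2) (i y2) (i l),
        (i x1 != i x2) || (i y1 + i y2 != 0) &
        slope_spec (res a2) (res a4) (res x1) (res y1) (res x2) (res y2)
          (res l)].
Proof.
move=> c1 c2 neg'.
have neg : (i x1 != i x2) || (i y1 + i y2 != 0).
  apply: contraTT neg'; rewrite !negb_or !negbK => /andP[/eqP ex /eqP ey].
  rewrite (int_incl_inj ex).
  have y12 : y1 + y2 = 0 by apply: int_incl_inj; rewrite rmorphD ey rmorph0.
  by rewrite -rmorphD y12 rmorph0 !eqxx.
have [L LP] := slope_exists c1 c2 neg; have [L1 L2] := LP.
have [l lE] : exists l : o, i l = L.
  have [ex|nex] := eqVneq (res x1) (res x2).
    have ry : res (y1 + y2) != 0 by move: neg'; rewrite ex eqxx rmorphD.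
    have [l [lE _]] :=
      res_div (x1 ^+ 2 + x1 * x2 + x2 ^+ 2 + a2 * (x1 + x2) + a4) ry.
    exists l; have /andP[y0 _] := res_unit ry; apply: (mulIf y0).
    by rewrite lE !(rmorphXn, rmorphD, rmorphM) L2.
  have rx : res (x2 - x1) != 0 by rewrite rmorphB subr_eq0 eq_sym.
  have [l [lE _]] := res_div (y2 - y1) rx.
  exists l; have /andP[x0 _] := res_unit rx; apply: (mulIf x0).
  by rewrite lE !rmorphB L1.
exists l; rewrite lE; split=> //; split.
  rewrite -!rmorphB -rmorphM; congr (res _); apply: int_incl_inj.
  by rewrite rmorphM !rmorphB lE.
rewrite -!rmorphXn -!rmorphD -!rmorphM -!rmorphD; congr (res _).
apply: int_incl_inj.
by rewrite !(rmorphXn, rmorphD, rmorphM) lE.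
Qed.

(** In terms of z = 1 / x2 and w = y2 / x2^2, which lie in the maximal ideal,
the coordinates of the sum are polynomials in z and w divided by powers of
D = 1 - x1 z, a unit; they can therefore be reduced by setting z = w = 0. *)
Lemma reduces_add_kernel (x1 y1 : o) (x2 y2 : K) :
    on_curve W (Affine (i x1) (i y1)) -> on_curve W (Affine x2 y2) ->
    x2 \notin vge v 0 ->
  reduces (addpt W (Affine (i x1) (i y1)) (Affine x2 y2))
    (Affine (res x1) (res y1)).
Proof.
move=> c1 c2 nox; have [x20 vx2] := nvint nox.
have /on_shortP E1 := c1; have /on_shortP E2 := c2.
have z1 : x2^-1 \in vge v 1.
  by rewrite inE dvalV // -[1]add0r lezD1 oppr_gt0 vx2 orbT.
have [z zE] := int_inclP (vge_le (ler01 : 0 <= 1 :> int) z1).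
have x2E : x2 = (i z)^-1 by rewrite -zE invrK.
have z0 : i z != 0 by rewrite -zE invr_eq0.
have rz : res z = 0 by apply: res0_max; rewrite -zE.
pose g := z + a2 * z ^+ 2 + a4 * z ^+ 3 + a6 * z ^+ 4.
have rg : res g = 0 by rewrite !(rmorphXn, rmorphM, rmorphD) rz; ring.
have igE : i g = i z + i a2 * i z ^+ 2 + i a4 * i z ^+ 3 + i a6 * i z ^+ 4.
  by rewrite !(rmorphXn, rmorphM, rmorphD).
have wE2 : (y2 / x2 ^+ 2) ^+ 2 = i g.
  rewrite expr_div_n E2 x2E igE; field.
  by rewrite z0 oner_neq0.
have w1 : y2 / x2 ^+ 2 \in vge v 1.
  by apply: (@vge1X _ _ 1%N); rewrite wE2; exact: (res_ker g).1 rg.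
have [w wE] := int_inclP (vge_le (ler01 : 0 <= 1 :> int) w1).
have rw : res w = 0 by apply: res0_max; rewrite -wE.
have y2E : y2 = i w / i z ^+ 2.
  by rewrite -wE x2E; field; rewrite z0 oner_neq0.
rewrite wE in wE2.
pose D := 1 - x1 * z.
have rD : res D = 1 by rewrite rmorphB rmorph1 rmorphM rz mulr0 subr0.
have iD : i D = 1 - i x1 * i z by rewrite rmorphB rmorph1 rmorphM.
clearbody D.
have /res_unit/andP[D0 _] : res D != 0 by rewrite rD oner_neq0.
have nex : i x1 != x2.
  by apply: contraNneq nox => <-; apply: int_incl_int.
have neg : (i x1 != x2) || (i y1 + y2 != 0) by rewrite nex.
have [l lP] := slope_exists c1 c2 neg; have [l1 _] := lP.
rewrite (addpt_short c1 neg lP).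
have lE : l = (i w - i y1 * i z ^+ 2) / (i z * i D).
  have dx : x2 - i x1 != 0 by rewrite subr_eq0 eq_sym.
  apply: (mulIf dx); rewrite l1 y2E x2E iD; field.
  by rewrite z0 -iD D0.
set x3 := l ^+ 2 - i a2 - i x1 - x2.
pose N := x1 + x1 ^+ 2 * z + 2%:R * a2 * x1 * z + a4 * (x1 * z ^+ 2 + z)
  + 2%:R * a6 * z ^+ 2 - 2%:R * y1 * w.
pose M := 3%:R * x1 ^+ 2 + 2%:R * a2 * x1 + a4 * (1 + x1 * z) + 2%:R * a6 * z
  - x1 ^+ 3 * z.
(* q = w^2 / z is a unit: it is the source of the change of sign from - y1 to
   y1 in the residue of the ordinate. *)
pose q := 1 + a2 * z + a4 * z ^+ 2 + a6 * z ^+ 3.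
pose N' := - (w * M - 2%:R * y1 * q - y1 * z ^+ 2 * M
  + 2%:R * y1 ^+ 2 * z * w + y1 * D ^+ 3).
have iX n (a : o) : i (a ^+ n) = i a ^+ n by apply: rmorphXn.
have iM (a b : o) : i (a * b) = i a * i b by apply: rmorphM.
have iDD (a b : o) : i (a + b) = i a + i b by apply: rmorphD.
have iN (a : o) : i (- a) = - i a by apply: rmorphN.
have in' n : i n%:R = n%:R by apply: rmorph_nat.
have i1 : i 1 = 1 by apply: rmorph1.
have rX n (a : o) : res (a ^+ n) = res a ^+ n by apply: rmorphXn.
have rM (a b : o) : res (a * b) = res a * res b by apply: rmorphM.
have rDD (a b : o) : res (a + b) = res a + res b by apply: rmorphD.
have rN (a : o) : res (- a) = - res a by apply: rmorphN.
have rn n : res n%:R = n%:R by apply: rmorph_nat.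
have r1 : res 1 = 1 by apply: rmorph1.
have x3E : x3 * i D ^+ 2 = i N.
  transitivity (i N + i z ^+ 2 * (i y1 ^+ 2
      - (i x1 ^+ 3 + i a2 * i x1 ^+ 2 + i a4 * i x1 + i a6))
    + (i w ^+ 2 - i g) / i z ^+ 2).
    rewrite /x3 lE x2E igE /N !(iX, iM, iDD, iN, in') iD.
    field; by rewrite z0 -iD D0.
  by rewrite wE2 E1 !subrr mulr0 mul0r !addr0.
have iq : i q = i g / i z.
  by rewrite igE /q !(iX, iM, iDD, iN, i1); field.
have rq : res q = 1.
  by rewrite /q !(rX, rM, rDD, r1) rz; ring.
clearbody q.
have x3x1 : (x3 - i x1) * i D ^+ 2 = i z * i M - 2%:R * i y1 * i w.
  rewrite mulrBl x3E iD /N /M !(iX, iM, iDD, iN, in', i1); ring.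
clearbody M.
have y3E : - (l * (x3 - i x1) + i y1) * i D ^+ 3 = i N'.
  transitivity (- ((i w - i y1 * i z ^+ 2) / i z
    * ((x3 - i x1) * i D ^+ 2) + i y1 * i D ^+ 3)).
    by rewrite lE; field; rewrite z0.
  rewrite x3x1 /N' !(iX, iM, iDD, iN, in', i1) iq -wE2; field.
  exact: z0.
have rD2 n : res (D ^+ n) != 0 by rewrite rX rD expr1n oner_neq0.
have [X [XE rXE]] := res_div N (rD2 2%N).
have [Y [YE rYE]] := res_div N' (rD2 3%N).
have Dn n : i D ^+ n != 0 by rewrite expf_neq0.
exists X, Y; split.
- by apply: (mulIf (Dn 2%N)); rewrite x3E -XE iX.
- by apply: (mulIf (Dn 3%N)); rewrite y3E -YE iX.
- rewrite rXE rX rD /N !(rX, rM, rDD, rN, rn) rz rw.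
  by field; rewrite oner_neq0.
- rewrite rYE rX rD /N' !(rX, rM, rDD, rN, rn, rD) rq rz rw.
  by field; rewrite oner_neq0.
Qed.

Hypothesis two_neq0 : 2%:R != 0 :> k.

(** The partial derivatives do not both vanish, in characteristic not 2. *)
Definition nonsingular (x y : k) : Prop :=
  y = 0 -> 3%:R * x ^+ 2 + 2%:R * res a2 * x + res a4 <> 0.

(** If the reduced points are opposite, an integral slope would satisfy the
residues of both slope equations, which makes y' and the derivative of the
cubic at x' vanish; so the slope and the sum are not integral. *)
Lemma reduces_add P Q x' y' Q' :
    on_curve W P -> on_curve W Q -> reduces P (Affine x' y') ->
    nonsingular x' y' -> reduces Q Q' ->
  reduces (addpt W P Q) (addpt W' (Affine x' y') Q').
Proof.
case: P => [|x y] // cP cQ [x1 [y1 [xE yE rx ry]]] ns redQ.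
subst x y x' y'.
case: Q Q' cQ redQ => [|x2 y2] [|x2' y2'] // cQ; last first.
  case=> x3 [y3 [xE yE rx ry]]; subst x2 y2 x2' y2'.
  move: x3 y3 cQ => x2 y2 cQ.
  have [/andP[/eqP ex /eqP ey]|] :=
      boolP ((res x1 == res x2) && (res y1 + res y2 == 0)); last first.
    rewrite negb_and => neg'.
    have [l [lP neg lP']] := reduces_chord cP cQ neg'.
    rewrite (addpt_short cP neg lP) (addpt_short (on_curve_res cP) neg' lP').
    exists (l ^+ 2 - a2 - x1 - x2), (- (l * (l ^+ 2 - a2 - x1 - x2 - x1) + y1)).
    by split; rewrite ?(rmorphB, rmorphD, rmorphM, rmorphXn, rmorphN).
  have -> : addpt W' (Affine (res x1) (res y1)) (Affine (res x2) (res y2)) =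
      Infinity.
    move: ey; rewrite ex addrC => /eqP; rewrite addr_eq0 => /eqP ->.
    exact: addpt_opposite.
  have [/andP[/eqP ex']|] :=
      boolP ((i x1 == i x2) && (i y1 + i y2 == 0)).
    by rewrite addrC addr_eq0 => /eqP ey'; rewrite ex' ey' addpt_opposite.
  rewrite negb_and => neg; have [L LP] := slope_exists cP cQ neg.
  rewrite (addpt_short cP neg LP) /=; apply/negP => ox3.
  have oL : L \in vge v 0.
    apply: (@vintX _ _ 1%N).
    have -> : L ^+ 2 = (L ^+ 2 - i a2 - i x1 - i x2) + i (a2 + x1 + x2).
      by rewrite !rmorphD; ring.
    by rewrite rpredD ?int_incl_int.
  have [l lE] := int_inclP oL; have [L1 L2] := LP; rewrite lE in L1 L2.
  have r1 : res l * (res x2 - res x1) = res y2 - res y1.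
    rewrite -!rmorphB -rmorphM; congr (res _); apply: int_incl_inj.
    by rewrite rmorphM !rmorphB.
  have r2 : res l * (res y1 + res y2) =
      3%:R * res x1 ^+ 2 + 2%:R * res a2 * res x1 + res a4.
    have -> : res l * (res y1 + res y2) = res (l * (y1 + y2)).
      by rewrite rmorphM rmorphD.
    have -> : l * (y1 + y2) =
        x1 ^+ 2 + x1 * x2 + x2 ^+ 2 + a2 * (x1 + x2) + a4.
      apply: int_incl_inj.
      by rewrite !(rmorphXn, rmorphD, rmorphM).
    by rewrite !(rmorphXn, rmorphD, rmorphM) -ex; ring.
  apply: ns; last by rewrite -r2 ey mulr0.
  move: r1; rewrite ex subrr mulr0 => /esym/eqP; rewrite subr_eq0 => /eqP e2.
  move: ey; rewrite e2 -mulr2n -mulr_natl => /eqP.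
  by rewrite mulf_eq0 (negPf two_neq0) => /eqP.
- by move=> nox; apply: reduces_add_kernel.
- by move=> _; exists x1, y1; split.
Qed.

End Reduction.

(** * Nodal cubics *)

Section NodalCubic.
Variables (F : fieldType) (c : F).
Hypotheses (c0 : c != 0) (two0 : 2%:R != 0 :> F).
Let W := short_curve (c ^+ 2) 0 0.

(** The parameter is u = (y + c x) / (y - c x), the quotient of the equations of
the two tangents at the node. *)
Definition node_x (u : F) : F := 4%:R * c ^+ 2 * u / (u - 1) ^+ 2.
Definition node_y (u : F) : F := c * (u + 1) / (u - 1) * node_x u.
Definition node_param (u : F) : point F :=
  if u == 1 then Infinity else Affine (node_x u) (node_y u).

Let four0 : 4%:R != 0 :> F.
Proof. by rewrite (natrM _ 2 2) mulf_neq0. Qed.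

Lemma node_param_on_curve u : on_curve W (node_param u).
Proof.
rewrite /node_param; case: eqVneq => // u1.
apply/on_shortP; rewrite /node_y /node_x; field.
by rewrite subr_eq0 u1.
Qed.

Lemma node_param_surj x y : on_curve W (Affine x y) -> x != 0 ->
  exists u, [/\ u != 0, u != 1 & node_param u = Affine x y].
Proof.
move=> /on_shortP; rewrite mul0r !addr0 => cP x0.
pose s := y / x.
have sE : (s - c) * (s + c) = x.
  transitivity (y ^+ 2 / x ^+ 2 - c ^+ 2); first by rewrite /s; field.
  by rewrite cP; field.
have yE : y = s * x by rewrite /s divfK.
have sc : s - c != 0 by apply: contra_neq x0 => e; rewrite -sE e mul0r.
have sc' : s + c != 0 by apply: contra_neq x0 => e; rewrite -sE e mulr0.
have u1E : (s + c) / (s - c) - 1 = 2%:R * c / (s - c) by field.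
have u1 : (s + c) / (s - c) != 1.
  by rewrite -subr_eq0 u1E !mulf_neq0 ?invr_eq0.
exists ((s + c) / (s - c)); split=> //.
  by rewrite mulf_neq0 ?invr_eq0.
have ex : node_x ((s + c) / (s - c)) = x.
  by rewrite /node_x u1E -sE; field; rewrite sc c0 two0.
rewrite /node_param (negPf u1) /node_y ex; congr Affine.
by rewrite u1E yE; field; rewrite sc c0 two0.
Qed.

(** In terms of the slopes s_i = y_i / x_i of the lines through the node, the
sum has slope (s1 s2 + c^2) / (s1 + s2), which is the addition formula of the
hyperbolic cotangent. *)
Lemma node_param_add u w : u != 0 -> w != 0 ->
  addpt W (node_param u) (node_param w) = node_param (u * w).
Proof.
move=> u0 w0; have [->|u1] := eqVneq u 1.
  by rewrite mul1r {1}/node_param eqxx.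
have [->|w1] := eqVneq w 1.
  rewrite mulr1 [in X in addpt _ _ X]/node_param eqxx.
  by case: (node_param u).
have u1' : u - 1 != 0 by rewrite subr_eq0.
have w1' : w - 1 != 0 by rewrite subr_eq0.
have cu := node_param_on_curve u; have cw := node_param_on_curve w.
rewrite /node_param (negPf u1) in cu *.
rewrite (negPf w1) in cw *.
have [uw1|uw1] := eqVneq (u * w) 1.
  have wE : w = u^-1 by apply: (mulfI u0); rewrite uw1 mulfV.
  have u1'' : 1 + -1 * u != 0 by rewrite mulN1r subr_eq0 eq_sym.
  have -> : node_x w = node_x u.
    rewrite /node_x wE; field.
    by rewrite u0 u1' u1''.
  have -> : node_y w = - node_y u.
    rewrite /node_y /node_x wE; field.
    by rewrite u0 u1' u1''.
  exact: addpt_opposite.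
have uw1' : u * w - 1 != 0 by rewrite subr_eq0.
have neg : (node_x u != node_x w) || (node_y u + node_y w != 0).
  apply/negPn/negP; rewrite negb_or !negbK => /andP[/eqP ex].
  have -> : node_y u + node_y w = node_x u * (2%:R * c * (u * w - 1)
      / ((u - 1) * (w - 1))).
    by rewrite /node_y -ex; field; rewrite u1' w1'.
  rewrite /node_x; apply/negP; rewrite !mulf_neq0 ?invr_eq0 ?mulf_neq0 //;
    by rewrite ?expf_neq0.
pose s1 := c * (u + 1) / (u - 1); pose s2 := c * (w + 1) / (w - 1).
have sE : s1 + s2 = 2%:R * c * (u * w - 1) / ((u - 1) * (w - 1)).
  by rewrite /s1 /s2; field; rewrite u1' w1'.
have s0 : s1 + s2 != 0 by rewrite sE !mulf_neq0 ?invr_eq0 ?mulf_neq0.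
have xE : node_x u = s1 ^+ 2 - c ^+ 2 by rewrite /node_x /s1; field.
have xE' : node_x w = s2 ^+ 2 - c ^+ 2 by rewrite /node_x /s2; field.
have yE : node_y u = s1 * (s1 ^+ 2 - c ^+ 2) by rewrite /node_y xE.
have yE' : node_y w = s2 * (s2 ^+ 2 - c ^+ 2) by rewrite /node_y xE'.
pose l := (s1 ^+ 2 + s1 * s2 + s2 ^+ 2 - c ^+ 2) / (s1 + s2).
have lP : slope_spec (c ^+ 2) 0 (node_x u) (node_y u) (node_x w) (node_y w) l.
  by split; rewrite xE xE' yE yE' /l; field.
rewrite (addpt_short cu neg lP) /chord_sum.
pose s3 := (s1 * s2 + c ^+ 2) / (s1 + s2).
have s3E : s3 = c * (u * w + 1) / (u * w - 1).
  rewrite /s3 sE /s1 /s2; field.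
  by rewrite uw1' c0 two0 u1' w1'.
have x3E : node_x (u * w) = s3 ^+ 2 - c ^+ 2.
  by rewrite s3E /node_x; field.
have -> : node_y (u * w) = s3 * (s3 ^+ 2 - c ^+ 2) by rewrite /node_y x3E s3E.
rewrite x3E xE xE' yE /l /s3.
by congr Affine; field.
Qed.

(** By Frobenius, u^p = 1 implies (u - 1)^p = 0. *)
Lemma nodal_no_torsion p x y : prime p -> p%:R = 0 :> F ->
    on_curve W (Affine x y) -> x != 0 ->
  mulpt W p (Affine x y) <> Infinity.
Proof.
move=> p_prime p0 cP x0.
have [u [u0 u1 <-]] := node_param_surj cP x0.
have -> : mulpt W p (node_param u) = node_param (u ^+ p).
  elim: (p) => [|n IHn]; first by rewrite expr0 /node_param eqxx.
  by rewrite /= -/(mulpt W n _) IHn node_param_add ?expf_neq0 // exprS.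
rewrite /node_param; case: eqVneq => // up _.
have chp : p \in [pchar F] by rewrite inE p_prime p0 eqxx.
have : (u - 1) ^+ p = 0.
  by rewrite -(pFrobenius_autE chp) rmorphB rmorph1 /= pFrobenius_autE up subrr.
by move/eqP; rewrite expf_eq0 subr_eq0 (negPf u1) andbF.
Qed.
End NodalCubic.

(** Here the reduced curve is y^2 = x^2 (x + a2) with a2 not a square: its
tangents at the node are not rational. *)
Section NonsplitNode.
Variables (K : fieldType) (v : dvaluation K).
Let o := ring_of_integers v.
Local Notation i := (int_incl v).
Variables (k : fieldType) (res : {rmorphism o -> k}).
Hypothesis res_ker : forall a, res a = 0 <-> a \in max_ideal v.
Variables (a2 a4 a6 : o).
Let W := short_curve (i a2) (i a4) (i a6).
Hypotheses (ra4 : res a4 = 0) (ra6 : res a6 = 0).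
Hypothesis a2_nonsquare : forall c, res a2 <> c ^+ 2.

Definition meets_node (P : point K) : Prop :=
  if P is Affine x y then x \in vge v 1 else False.

Lemma meets_nodeP P : on_curve W P -> meets_node P ->
  exists x y : o, [/\ P = Affine (i x) (i y), res x = 0 & res y = 0].
Proof.
case: P => [|x y] // cP /= x1.
have ox := vge_le (ler01 : 0 <= 1 :> int) x1.
have [a aE] := int_inclP ox.
have [b bE] := int_inclP (curve_ordinate_int cP ox).
have ra : res a = 0 by apply: res0_max => //; rewrite -aE.
exists a, b; split=> //; first by rewrite aE bE.
have := @on_curve_res _ _ _ res a2 a4 a6 a b.
rewrite -aE -bE => /(_ cP)/on_shortP.
rewrite ra ra6 !expr0n /= !mulr0 !addr0 => /eqP.
by rewrite expf_eq0 => /eqP.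
Qed.

(** If the abscissa of the sum reduced to 0, the slope would be integral and the
square of its residue would be the residue of a2. *)
Lemma meets_node_add P Q : on_curve W P -> on_curve W Q ->
  meets_node P -> meets_node Q -> ~ meets_node (addpt W P Q).
Proof.
move=> cP cQ /(meets_nodeP cP)[x1 [y1 [PE rx1 ry1]]].
move=> /(meets_nodeP cQ)[x2 [y2 [QE rx2 ry2]]].
rewrite {P}PE {Q}QE in cP cQ *.
have [/andP[/eqP -> ]|] := boolP ((i x1 == i x2) && (i y1 + i y2 == 0)).
  by rewrite addrC addr_eq0 => /eqP ->; rewrite addpt_opposite.
rewrite negb_and => neg; have [L LP] := slope_exists cP cQ neg.
rewrite (addpt_short cP neg LP) /= => x3.
have [z zE] := int_inclP (vge_le (ler01 : 0 <= 1 :> int) x3).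
have rz : res z = 0 by apply: res0_max => //; rewrite -zE.
have LE : L ^+ 2 = i (z + x2 + x1 + a2).
  by rewrite !rmorphD -zE !subrK.
have [l lE] : exists l : o, L = i l.
  by apply/int_inclP/(@vintX _ _ 1%N); rewrite LE int_incl_int.
apply: (a2_nonsquare (c := res l)).
have : l ^+ 2 = z + x2 + x1 + a2.
  by apply: int_incl_inj; rewrite rmorphXn -lE LE.
by move/(congr1 res); rewrite rmorphXn !rmorphD rz rx1 rx2 !add0r.
Qed.

(** A line through the node and a nonsingular point meets the reduced cubic
twice at the node. *)
Lemma meets_node_coset P Q : on_curve W P -> on_curve W Q ->
  meets_node P -> ~ meets_node Q -> meets_node (addpt W P Q).
Proof.
move=> cP cQ Pn nQ; have [x1 [y1 [PE rx1 ry1]]] := meets_nodeP cP Pn.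
rewrite {}PE in cP Pn *.
have [QI|[x2 [y2 QE]]] : Q = Infinity \/ exists x y, Q = Affine x y.
  by case: (Q) => [|x y]; [left | right; exists x, y].
  by rewrite QI.
rewrite {Q}QE in cQ nQ *.
have [ox|nox] := boolP (x2 \in vge v 0); last first.
  have := reduces_add_kernel res_ker cP cQ nox.
  case: (addpt _ _ _) => [|x y] //= [a [b [-> _ ra _]]].
  by apply/(res_ker a); rewrite ra.
have [a aE] := int_inclP ox.
have [b bE] := int_inclP (curve_ordinate_int cQ ox).
rewrite {x2}aE {y2}bE in cQ nQ ox *.
have ra : res a != 0 by apply/eqP => /res_ker.
have neg' : (res x1 != res a) || (res y1 + res b != 0) by rewrite rx1 eq_sym ra.
have [l [lP neg [l1 _]]] := reduces_chord res_ker cP cQ neg'.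
rewrite (addpt_short cP neg lP) /=.
have -> : i l ^+ 2 - i a2 - i x1 - i a = i (l ^+ 2 - a2 - x1 - a).
  by rewrite !rmorphB rmorphXn.
suff : res (l ^+ 2 - a2 - x1 - a) = 0 by move/res_ker.
apply: (mulIf (expf_neq0 2 ra)); rewrite mul0r.
have /on_shortP := on_curve_res res cQ; rewrite ra4 ra6 mul0r !addr0 => bE.
rewrite rx1 ry1 !subr0 in l1.
rewrite !rmorphB rmorphXn rx1 subr0.
transitivity ((res l * res a) ^+ 2 - (res a ^+ 3 + res a2 * res a ^+ 2)).
  by ring.
by rewrite l1 bE subrr.
Qed.

Lemma meets_node_mulpt n P : on_curve W P -> meets_node P ->
  meets_node (mulpt W n P) <-> odd n.
Proof.
move=> cP Pn; elim: n => [|n [IH1 IH2]] //=; rewrite -/(mulpt W n P).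
have cn : on_curve W (mulpt W n P) by apply: mulpt_on_curve.
have [on|en] := boolP (odd n); split=> //.
- by move/(meets_node_add cP cn Pn (IH2 on)).
- by move=> _; apply: meets_node_coset => // /IH1; apply/negP.
Qed.

End NonsplitNode.

(** * Torsion on short models *)

Lemma disc_change (F : fieldType) (W W' : weierstrass F) (u r s t : F) :
  is_change W W' u r s t -> disc W = u ^+ 12 * disc W'.
Proof.
move=> H; have [E1 E2 E3 E4 E6] := is_change_solve H.
by rewrite /disc E6 E4 E3 E2 E1; ring.
Qed.

Lemma short_disc_nonsingular (F : fieldType) (a2 a4 a6 x : F) :
    on_curve (short_curve a2 a4 a6) (Affine x 0) ->
    disc (short_curve a2 a4 a6) != 0 ->
  3%:R * x ^+ 2 + 2%:R * a2 * x + a4 <> 0.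
Proof.
move=> /on_shortP; rewrite expr0n /= => cP /eqP disc0 sing; apply: disc0.
have e4 : a4 = - (3%:R * x ^+ 2 + 2%:R * a2 * x).
  by apply/eqP; rewrite -addr_eq0 addrC sing.
have e6 : a6 = - (x ^+ 3 + a2 * x ^+ 2 + a4 * x).
  by apply/eqP; rewrite -addr_eq0 addrC -cP.
by rewrite /disc /= e6 e4; ring.
Qed.

Lemma residue_ker_comp (K : fieldType) (v : dvaluation K) (k l : fieldType)
    (res : {rmorphism ring_of_integers v -> k}) (j : {rmorphism k -> l}) :
    (forall a, res a = 0 <-> a \in max_ideal v) ->
  forall a, (j \o res) a = 0 <-> a \in max_ideal v.
Proof.
move=> res_ker a; rewrite -res_ker /=; split=> [/eqP|->]; last exact: rmorph0.
by rewrite fmorph_eq0 => /eqP.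
Qed.

Section TorsionOfShortModels.
Variables (K : fieldType) (v : dvaluation K) (p : nat).
Hypotheses (p_prime : prime p) (p_gt2 : (2 < p)%N).
Hypotheses (vp : v p%:R = 1) (p_neq0 : p%:R != 0 :> K).
Let o := ring_of_integers v.
Local Notation i := (int_incl v).
Variables (k : fieldType) (res : {rmorphism o -> k}).
Hypothesis res_ker : forall a, res a = 0 <-> a \in max_ideal v.
Variables (a2 a4 a6 : o).
Let W := short_curve (i a2) (i a4) (i a6).

Let odd_p : odd p.
Proof. by case: (even_prime p_prime) p_gt2 => [->|]. Qed.

Lemma residue_char : p%:R = 0 :> k.
Proof.
rewrite -(rmorph_nat res); apply: res0_max => //.
by rewrite rmorph_nat inE vp lexx orbT.
Qed.

Lemma residue_two_neq0 : 2%:R != 0 :> k.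
Proof.
apply/eqP => k2.
have /eqP : 1 = 0 :> k.
  rewrite -residue_char -(odd_double_half p).
  by rewrite odd_p natrD -mul2n natrM k2 mul0r addr0.
by rewrite oner_eq0.
Qed.

Section Reduce.
Variables (l : fieldType) (rho : {rmorphism o -> l}).
Hypothesis rho_ker : forall a, rho a = 0 <-> a \in max_ideal v.
Hypothesis two_l : 2%:R != 0 :> l.
Let W' := short_curve (rho a2) (rho a4) (rho a6).

Lemma reduces_torsion P x' y' : on_curve W P ->
    reduces rho P (Affine x' y') -> nonsingular rho a2 a4 x' y' ->
    mulpt W p P = Infinity ->
  mulpt W' p (Affine x' y') = Infinity.
Proof.
move=> cP redP ns Ptors.
have : reduces rho (mulpt W p P) (mulpt W' p (Affine x' y')).
  elim: (p) => [//|n IHn]; rewrite /= -/(mulpt W n P).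
  by apply: reduces_add => //; apply: mulpt_on_curve.
by rewrite Ptors; case: (mulpt _ _ _).
Qed.

(** The torsion point is integral, so it does not reduce to Infinity. *)
Lemma good_reduction_torsion x y : disc W' != 0 ->
    torsion_point W p (Affine x y) ->
  exists x' y', torsion_point W' p (Affine x' y').
Proof.
move=> disc0 [cP Ptors].
have ox : x \in vge v 0.
  by apply: (integral_torsion _ _ vp _ _ _ _ cP Ptors) => //;
    apply: int_incl_int.
have [a aE] := int_inclP ox.
have [b bE] := int_inclP (curve_ordinate_int cP ox).
exists (rho a), (rho b).
have cP' : on_curve W' (Affine (rho a) (rho b)).
  by apply: on_curve_res; rewrite -aE -bE.
split=> //; apply: (reduces_torsion cP) => //; first by exists a, b.
move=> b0; rewrite b0 in cP'.
exact: short_disc_nonsingular cP' disc0.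
Qed.
End Reduce.

Variables (kbar : closedFieldType) (jk : {rmorphism k -> kbar}).

Lemma sqrt_closed (c : kbar) : exists d, c = d ^+ 2.
Proof.
have [d dE] := @solve_monicpoly kbar 2 (fun n => if n == 0%N then c else 0) isT.
exists d; rewrite dE !big_ord_recl big_ord0 /=.
by rewrite expr0 mulr1 mul0r !addr0.
Qed.

(** Over the closure kbar the node becomes split and a point that avoids it lies
in a multiplicative group; a point that meets it has no odd torsion. *)
Lemma nonsplit_node_no_torsion x y :
    res a4 = 0 -> res a6 = 0 -> (forall c, res a2 <> c ^+ 2) ->
  ~ torsion_point W p (Affine x y).
Proof.
move=> ra4 ra6 nsq [cP Ptors].
have ox : x \in vge v 0.
  by apply: (integral_torsion _ _ vp _ _ _ _ cP Ptors) => //;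
    apply: int_incl_int.
have [node|nnode] := boolP (x \in vge v 1).
  have := meets_node_mulpt res_ker ra4 ra6 nsq p cP node.
  rewrite Ptors; by case=> _; apply.
have [a aE] := int_inclP ox.
have [b bE] := int_inclP (curve_ordinate_int cP ox).
pose rho : {rmorphism o -> kbar} := jk \o res.
have rho_ker := residue_ker_comp jk res_ker.
have two : 2%:R != 0 :> kbar.
  by rewrite -(rmorph_nat jk) fmorph_eq0 residue_two_neq0.
have [c cE] := sqrt_closed (rho a2).
have a20 : rho a2 != 0.
  by rewrite fmorph_eq0; apply/eqP => a20; apply: (nsq 0); rewrite a20 expr0n.
have c0 : c != 0 by apply: contra_neq a20 => c0; rewrite cE c0 expr0n.
have ra : rho a != 0.
  apply/eqP => /rho_ker; rewrite inE; apply/negP.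
  by rewrite -[int_val a]/(i a) -aE.
have cP' : on_curve (short_curve (rho a2) (rho a4) (rho a6))
    (Affine (rho a) (rho b)).
  by apply: on_curve_res; rewrite -aE -bE.
have r4 : rho a4 = 0 by rewrite /= ra4 rmorph0.
have r6 : rho a6 = 0 by rewrite /= ra6 rmorph0.
have ns : nonsingular rho a2 a4 (rho a) (rho b).
  move=> b0; move: cP' => /on_shortP; rewrite b0 r4 r6 expr0n /= => E S.
  have /eqP E' : rho a ^+ 2 * (rho a + rho a2) = 0 by rewrite [RHS]E; ring.
  have /eqP S' : rho a * (3%:R * rho a + 2%:R * rho a2) = 0.
    by rewrite -[RHS]S; ring.
  move: E' S'; rewrite !mulf_eq0 !(negPf ra) /= => /eqP E' /eqP S'.
  case/eqP: a20.
  transitivity (3%:R * (rho a + rho a2) - (3%:R * rho a + 2%:R * rho a2)).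
    by ring.
  by rewrite E' S' mulr0 subr0.
have red : reduces rho (Affine x y) (Affine (rho a) (rho b)) by exists a, b.
have := reduces_torsion rho_ker two cP red ns Ptors.
rewrite r4 r6 cE in cP' *.
apply: nodal_no_torsion => //.
by rewrite -(rmorph_nat jk) residue_char rmorph0.
Qed.
End TorsionOfShortModels.

(** * Torsion and reduction types *)

Section CompleteSquare.
Variables (R : comNzRingType) (W : weierstrass R) (h r : R).
Let s := - (h * wa1 W).
Let t := - (h * (wa3 W + r * wa1 W)).

(** The coefficients after the substitution x = x' + r, y = y' + s x' + t, where
s and t are chosen, with h = 1/2, to kill the terms in x y and in y. *)
Definition square_a2 : R := wa2 W - s * wa1 W + 3%:R * r - s ^+ 2.
Definition square_a4 : R :=
  wa4 W - s * wa3 W + 2%:R * r * wa2 W - (t + r * s) * wa1 W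
  + 3%:R * r ^+ 2 - 2%:R * s * t.
Definition square_a6 : R :=
  wa6 W + r * wa4 W + r ^+ 2 * wa2 W + r ^+ 3 - t * wa3 W - t ^+ 2
  - r * t * wa1 W.
End CompleteSquare.

Section CompleteSquareMap.
Variables (R S : comNzRingType) (f : {rmorphism R -> S}).
Variables (W : weierstrass R) (h r : R).

Lemma square_a2_map :
  f (square_a2 W h r) = square_a2 (map_weierstrass f W) (f h) (f r).
Proof.
by rewrite /square_a2 /=
  !(rmorph_nat, rmorphXn, rmorphB, rmorphN, rmorphD, rmorphM).
Qed.

Lemma square_a4_map :
  f (square_a4 W h r) = square_a4 (map_weierstrass f W) (f h) (f r).
Proof.
by rewrite /square_a4 /=
  !(rmorph_nat, rmorphXn, rmorphB, rmorphN, rmorphD, rmorphM).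
Qed.

Lemma square_a6_map :
  f (square_a6 W h r) = square_a6 (map_weierstrass f W) (f h) (f r).
Proof.
by rewrite /square_a6 /= !(rmorphXn, rmorphB, rmorphN, rmorphD, rmorphM).
Qed.
End CompleteSquareMap.

Lemma complete_square_change (F : fieldType) (W : weierstrass F) (h r : F) :
    2%:R * h = 1 ->
  is_change W
    (short_curve (square_a2 W h r) (square_a4 W h r) (square_a6 W h r))
    1 r (- (h * wa1 W)) (- (h * (wa3 W + r * wa1 W))).
Proof.
move=> h2; split; first exact: oner_neq0.
split; rewrite /= ?expr1n mul1r //.
  by rewrite mulrN mulrA h2 mul1r subrr.
by rewrite mulrN mulrA h2 mul1r subrr.
Qed.

(** A double root x of (X - x)^2 (X - x1) is a rational function of the
coefficients: b2^2 - 3 b4 = (x - x1)^2 and 9 b6 - b2 b4 = 2 x (x - x1)^2, where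
x - x1 = 3 x + b2.  The formula is also valid in characteristic 3. *)
Lemma double_root_rational (F : fieldType) (b2 b4 b6 x : F) :
    3%:R * x ^+ 2 + 2%:R * b2 * x + b4 = 0 ->
    x ^+ 3 + b2 * x ^+ 2 + b4 * x + b6 = 0 ->
    2%:R != 0 :> F -> 3%:R * x + b2 != 0 ->
  x = (9%:R * b6 - b2 * b4) / (2%:R * (b2 ^+ 2 - 3%:R * b4)).
Proof.
move=> d1 d0 two dx.
have e4 : b4 = - (3%:R * x ^+ 2 + 2%:R * b2 * x).
  by apply/eqP; rewrite -addr_eq0 addrC d1.
have e6 : b6 = - (x ^+ 3 + b2 * x ^+ 2 + b4 * x).
  by apply/eqP; rewrite -addr_eq0 addrC d0.
have D : b2 ^+ 2 - 3%:R * b4 = (3%:R * x + b2) ^+ 2 by rewrite e4; ring.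
have D0 : 2%:R * (b2 ^+ 2 - 3%:R * b4) != 0.
  by rewrite D mulf_neq0 // expf_neq0.
by apply: (mulIf D0); rewrite divfK // D e6 e4; ring.
Qed.

Section Models.
Variables (K : fieldType) (v : dvaluation K) (p : nat).
Hypotheses (p_prime : prime p) (p_gt2 : (2 < p)%N).
Hypotheses (vp : v p%:R = 1) (p_neq0 : p%:R != 0 :> K).
Let o := ring_of_integers v.
Local Notation i := (int_incl v).
Variables (k : fieldType) (res : {rmorphism o -> k}).
Hypothesis k_residue : is_residue_field res.
Variables (kbar : closedFieldType) (jk : {rmorphism k -> kbar}).
Variable E : weierstrass K.
Hypothesis E_torsion : exists2 P, torsion_point E p P & P <> Infinity.

Let res_ker : forall a, res a = 0 <-> a \in max_ideal v.
Proof. by case: k_residue. Qed.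

Lemma half_exists : exists h : o, 2%:R * h = 1.
Proof.
have u2 : vunit v 2%:R by apply: (vunit_nat p_prime vp).
have [h hE] := int_inclP (vunitV_int u2); exists h.
apply: int_incl_inj; rewrite rmorphM rmorph_nat rmorph1 -hE mulfV //.
by case/andP: u2.
Qed.

Lemma short_model_torsion (W : weierstrass o) (h r : o) :
    2%:R * h = 1 -> integral_model E W ->
  exists x y, torsion_point
    (short_curve (i (square_a2 W h r)) (i (square_a4 W h r))
       (i (square_a6 W h r))) p (Affine x y).
Proof.
move=> h2 [u [r0 [s0 [t0 EW]]]].
have [P Ptors P0] := E_torsion.
have EW' : is_change E (map_weierstrass i W) u r0 s0 t0 by [].
have h2' : 2%:R * i h = 1 by rewrite -(rmorph_nat i) -rmorphM h2 rmorph1.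
have := is_change_trans EW' (complete_square_change _ (i r) h2').
rewrite -square_a2_map -square_a4_map -square_a6_map => EW2.
move/(torsion_change EW2): Ptors; case: P P0 => // x y _ Ptors.
by do 2!eexists; apply: Ptors.
Qed.

(** The torsion point of E reduces to an affine torsion point of the short model
of the reduced curve, from which it is carried back to the reduced curve. *)
Lemma no_good_supersingular : ~ good_supersingular_reduction E res jk p.
Proof.
case=> Et [[W [EW _] EtE] disc0 noTors].
have [h h2] := half_exists.
have [x [y Ptors]] := short_model_torsion 0 h2 EW.
pose rho : {rmorphism o -> kbar} := jk \o res.
have rho_ker := residue_ker_comp jk res_ker.
have two : 2%:R != 0 :> kbar.
  rewrite -(rmorph_nat jk) fmorph_eq0.
  exact: (residue_two_neq0 p_prime p_gt2 vp res_ker).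
have rh2 : 2%:R * rho h = 1 by rewrite -(rmorph_nat rho) -rmorphM h2 rmorph1.
have rhoW : map_weierstrass jk Et = map_weierstrass rho W by rewrite EtE.
have := complete_square_change (map_weierstrass rho W) (rho 0) rh2.
rewrite -square_a2_map -square_a4_map -square_a6_map => change.
have discW : disc (map_weierstrass rho W) = jk (disc Et).
  rewrite EtE /disc /=.
  by rewrite !(rmorph_nat, rmorphXn, rmorphB, rmorphN, rmorphD, rmorphM).
have disc0' : disc (short_curve (rho (square_a2 W h 0))
    (rho (square_a4 W h 0)) (rho (square_a6 W h 0))) != 0.
  rewrite -[X in X != 0]mul1r -(expr1n _ 12) -(disc_change change) discW.
  by rewrite fmorph_eq0.
have [x' [y' Ptors']] :=
  good_reduction_torsion p_prime p_gt2 vp p_neq0 rho_ker two disc0' Ptors.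
have [Q QE] := change_point_surj change x' y'.
rewrite -QE in Ptors'.
have := noTors Q; rewrite rhoW (torsion_change change) => /(_ Ptors') Q0.
by rewrite Q0 in QE.
Qed.

(** The node is rational, being the double root of a cubic, and lifts to an
integral abscissa r.  Translating by r and completing the square gives the
reduced curve y^2 = x^2 (x + a2) with a2 = ((s1 - s2) / 2)^2, so the slopes
s1 and s2 are rational as soon as a2 is a square in the residue field. *)
Lemma no_nonsplit_multiplicative :
  ~ nonsplit_multiplicative_reduction E res jk.
Proof.
case=> Et [[W [EW _] EtE] [x0 [y0 [s1 [s2 [[sing slopes] s12 nrat]]]]]].
have [h h2] := half_exists.
pose rho : {rmorphism o -> kbar} := jk \o res.
have two : 2%:R != 0 :> kbar.
  rewrite -(rmorph_nat jk) fmorph_eq0.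
  exact: (residue_two_neq0 p_prime p_gt2 vp res_ker).
set V := map_weierstrass jk Et in sing slopes.
pose hb := jk (res h).
have hb2 : 2%:R * hb = 1.
  by rewrite /hb -[2%:R](rmorph_nat jk) -(rmorph_nat res) -!rmorphM h2 !rmorph1.
have hbE : hb = 2%:R^-1 by apply: (mulfI two); rewrite hb2 mulfV.
have slopesE z : z ^+ 2 + wa1 V * z - (3%:R * x0 + wa2 V) =
    (z - s1) * (z - s2).
  by have := congr1 (fun q : {poly kbar} => q.[z]) slopes; rewrite !hornerE.
have prod_s : wa2 V = - (s1 * s2) - 3%:R * x0.
  transitivity (- (0 ^+ 2 + wa1 V * 0 - (3%:R * x0 + wa2 V)) - 3%:R * x0).
    by ring.
  by rewrite slopesE; ring.
have sum_s : wa1 V = - (s1 + s2).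
  transitivity ((1 ^+ 2 + wa1 V * 1 - (3%:R * x0 + wa2 V)) - 1
    + (3%:R * x0 + wa2 V)); first by ring.
  by rewrite slopesE prod_s; ring.
have [w0 dx dy] := sing.
have y0E : y0 = - (hb * (wa1 V * x0 + wa3 V)).
  apply: (mulfI two); rewrite mulrN mulrA hb2 mul1r.
  by apply/eqP; rewrite -addr_eq0 addrA dy.
pose b2 := square_a2 V hb 0; pose b4 := square_a4 V hb 0.
pose b6 := square_a6 V hb 0.
have b2E : 3%:R * x0 + b2 = (hb * (s1 - s2)) ^+ 2.
  by rewrite /b2 /square_a2 sum_s prod_s hbE; field.
have d1 : 3%:R * x0 ^+ 2 + 2%:R * b2 * x0 + b4 = 0.
  rewrite -oppr0 -dx y0E /b2 /b4 /square_a2 /square_a4 hbE; field.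
  exact: two.
have d0 : x0 ^+ 3 + b2 * x0 ^+ 2 + b4 * x0 + b6 = 0.
  rewrite -oppr0 -w0 /weq y0E /b2 /b4 /b6 /square_a2 /square_a4 /square_a6 hbE.
  field; exact: two.
(* Effect of the translation by z on the short model: Taylor expansion. *)
have shift2 z : square_a2 V hb z = 3%:R * z + b2.
  by rewrite /b2 /square_a2; ring.
have shift4 z : square_a4 V hb z = 3%:R * z ^+ 2 + 2%:R * b2 * z + b4.
  by rewrite /b2 /b4 /square_a2 /square_a4; ring.
have shift6 z : square_a6 V hb z = z ^+ 3 + b2 * z ^+ 2 + b4 * z + b6.
  by rewrite /b2 /b4 /b6 /square_a2 /square_a4 /square_a6; ring.
have hb0 : hb != 0 by rewrite hbE invr_eq0.
have [q qE] : exists q, x0 = jk q.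
  pose c2 := square_a2 Et (res h) 0; pose c4 := square_a4 Et (res h) 0.
  pose c6 := square_a6 Et (res h) 0.
  exists ((9%:R * c6 - c2 * c4) / (2%:R * (c2 ^+ 2 - 3%:R * c4))).
  rewrite (double_root_rational d1 d0 two); last first.
    by rewrite b2E expf_neq0 // mulf_neq0 // subr_eq0; apply/eqP.
  have c2E : jk c2 = b2 by rewrite square_a2_map rmorph0.
  have c4E : jk c4 = b4 by rewrite square_a4_map rmorph0.
  have c6E : jk c6 = b6 by rewrite square_a6_map rmorph0.
  rewrite fmorph_div; congr (_ / _).
    by rewrite rmorphB !rmorphM rmorph_nat c2E c4E c6E.
  by rewrite rmorphM rmorphB rmorphXn rmorphM !rmorph_nat c2E c4E.
have [/(_ q)[r rq] _] := k_residue.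
have [x [y Ptors]] := short_model_torsion r h2 EW.
have rW : map_weierstrass res W = Et by rewrite EtE.
apply: (nonsplit_node_no_torsion p_prime p_gt2 vp p_neq0 res_ker jk
  _ _ _ Ptors).
- apply: (fmorph_inj jk); rewrite square_a4_map rq rW square_a4_map -qE.
  by rewrite [LHS]shift4 d1 rmorph0.
- apply: (fmorph_inj jk); rewrite square_a6_map rq rW square_a6_map -qE.
  by rewrite [LHS]shift6 d0 rmorph0.
move=> c /(congr1 jk); rewrite square_a2_map rq rW square_a2_map -qE.
rewrite [square_a2 _ _ _]shift2 b2E rmorphXn => /eqP.
have half_sum z : z = hb * z + hb * z.
  by rewrite -mulrDl -mulr2n -mulr_natl hb2 mul1r.
have s1E : s1 = - (hb * wa1 V) + hb * (s1 - s2).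
  by rewrite sum_s {1}(half_sum s1); ring.
have s2E : s2 = - (hb * wa1 V) - hb * (s1 - s2).
  by rewrite sum_s {1}(half_sum s2); ring.
have aE : - (hb * wa1 V) = jk (- (res h * wa1 Et)) by rewrite rmorphN rmorphM.
rewrite eqf_sqr => /orP[]/eqP e; apply: nrat; split.
- by exists (- (res h * wa1 Et) + c); rewrite s1E e aE rmorphD.
- by exists (- (res h * wa1 Et) - c); rewrite s2E e aE rmorphB.
- by exists (- (res h * wa1 Et) - c); rewrite s1E e aE rmorphB.
- by exists (- (res h * wa1 Et) + c); rewrite s2E e aE opprK rmorphD.
Qed.
End Models.

(** By Frobenius, the residue of zeta satisfies (zeta - 1)^p = 0. *)
Lemma root_of_unity_residue (L : fieldType) (w : dvaluation L)
    (k : fieldType) (res : {rmorphism ring_of_integers w -> k})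
    (p : nat) (zeta : ring_of_integers w) :
    (forall a, res a = 0 <-> a \in max_ideal w) -> prime p ->
    p%:R \in vge w 1 -> int_val zeta ^+ p = 1 ->
  res zeta = 1.
Proof.
move=> res_ker p_prime p1 zp.
have p0 : p%:R = 0 :> k.
  by rewrite -(rmorph_nat res); apply: res0_max; rewrite ?rmorph_nat.
have chp : p \in [pchar k] by rewrite inE p_prime p0 eqxx.
have rz : res zeta ^+ p = 1.
  rewrite -rmorphXn -(rmorph1 res); congr (res _).
  by apply: (@int_incl_inj _ w); rewrite rmorphXn rmorph1.
have : (res zeta - 1) ^+ p = 0.
  rewrite -(pFrobenius_autE chp) rmorphB rmorph1 /= pFrobenius_autE rz.
  exact: subrr.
by move/eqP; rewrite expf_eq0 subr_eq0 => /andP[_ /eqP].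
Qed.

Theorem theorem6p6
  (p : nat) (p_prime : prime p) (p_gt2 : (2 < p)%N)
  (* K is finite over Qp, with absolute ramification index 1 *)
  (Qp : fieldType) (vp : dvaluation Qp) (Qp_padic : is_padic_numbers p vp)
  (K : fieldExtType Qp) (vK : dvaluation K) (K_unram : lies_over vp vK 1)
  (* L = K(zeta) with its prime over that of K *)
  (L : fieldExtType K) (vL : dvaluation L)
  (vL_over : exists e, lies_over vK vL e)
  (zeta : ring_of_integers vL)
  (zeta_prim : p.-primitive_root (int_val zeta))
  (L_gen : <<1; int_val zeta>>%VS = fullv)
  (* E has a non-trivial K-rational p-torsion point *)
  (E : weierstrass K) (E_elliptic : disc E != 0)
  (E_torsion : exists2 P, torsion_point E p P & P <> Infinity)
  (* F = K(E[p]), of degree at least 2 over L *)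
  (F : fieldExtType L)
  (Kbar : closedFieldType) (j : {rmorphism F -> Kbar})
  (Kbar_closure : is_algebraic_closure j)
  (F_gen : let iK (a : K) : Kbar := j ((a%:A : L)%:A) in
     forall z : Kbar, (exists a : F, z = j a) <->
       generated_subfield
         (fun s => (exists a : K, s = iK a)
                   \/ torsion_coordinate (map_weierstrass iK E) p s) z)
  (F_degree : (2 <= \dim {:F})%N)
  (* the residue fields of K and L *)
  (kK : fieldType) (resK : {rmorphism ring_of_integers vK -> kK})
  (kK_residue : is_residue_field resK)
  (kKbar : closedFieldType) (jk : {rmorphism kK -> kKbar})
  (kKbar_closure : is_algebraic_closure jk)
  (k : fieldType) (resL : {rmorphism ring_of_integers vL -> k})
  (k_residue : is_residue_field resL) :
  [/\ ~ good_supersingular_reduction E resK jk p,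
      ~ nonsplit_multiplicative_reduction E resK jk
    & forall x : ring_of_integers vL,
        (* F is generated over L by a p-th root of x *)
        (exists2 y : F, y ^+ p = (int_val x)%:A & <<1; y>>%VS = fullv) ->
      forall r : nat, (1 <= r <= p.-1)%N ->
        [\/ good_ordinary_reduction E resK jk p,
            split_multiplicative_reduction E resK jk
          | additive_reduction E resK jk] ->
        let J_k := base_change_scalar resL (jackson_scalar zeta x r) in
        (x \notin max_ideal vL -> isomorphic_algebras J_k (@weyl_scalar k))
        /\ (x \in max_ideal vL ->
              isomorphic_algebras (B := {mpoly k[3]}) J_k (@mpolyC 3 k))].
Proof.
have [Qp_char0 vpp _ _] := Qp_padic.
have pQ0 : p%:R != 0 :> Qp.
  by have /pcharf0P -> := Qp_char0; rewrite -lt0n prime_gt0.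
have pK : (p%:R : Qp)%:A = p%:R :> K by rewrite scaler_nat.
have pK0 : p%:R != 0 :> K by rewrite -pK scaler_eq0 negb_or pQ0 oner_neq0.
have vKp : vK p%:R = 1.
  by have [_ /(_ _ pQ0)] := K_unram; rewrite pK vpp.
have [e [e_gt0 eP]] := vL_over.
have pL : (p%:R : K)%:A = p%:R :> L by rewrite scaler_nat.
have vLp : p%:R \in vge vL 1.
  have := eP _ pK0; rewrite pL vKp mulr1 inE => ->.
  by rewrite orbC lez_nat e_gt0.
have kL : forall a, resL a = 0 <-> a \in max_ideal vL by case: k_residue.
have rz : resL zeta = 1.
  by apply: (root_of_unity_residue kL p_prime vLp); apply: prim_expr_order.
split.
- exact: (no_good_supersingular p_prime p_gt2 vKp pK0 kK_residue E_torsion).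
- exact: (no_nonsplit_multiplicative p_prime p_gt2 vKp pK0 kK_residue
    E_torsion).
move=> x _ r _ _ J_k; split=> [nx|mx].
  apply: (@jackson_weyl_iso k (resL x)) => //.
  by apply/eqP => /kL; apply/negP.
by apply: jackson_mpoly_iso => //; apply/kL.
Qed.
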